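(* Let $S$ be an affine noetherian scheme and let $G$ be a group scheme which is affine and of finite type over $S$. Assume that $G$ is linearly reductive, that $G$ has the resolution property, and that the $\mathcal{O}_S$-module $\mathcal{O}_S[G]$ is locally projective. Let $X$ be an affine noetherian $S$-scheme with a $G$-action. Then there exists a $G$-equivariant vector bundle $V\to S$ with $V^G=0$ whose pullback to $X$ admits a $G$-equivariant section whose vanishing locus is the fixed locus $X^G$ (equality of closed subschemes of $X$).
   Context: $\mathcal{O}_S[G]$ denotes the quasi-coherent Hopf algebra over $\mathcal{O}_S$ whose relative spectrum is $G$. A quasi-coherent $\mathcal{O}_S$-module $\mathcal{F}$ is locally projective if $\mathcal{F}(U)$ is a projective $\mathcal{O}_S(U)$-module for every affine open $U\subset S$ (so the assumption on $\mathcal{O}_S[G]$ implies that $G$ is flat over $S$). A $G$-equivariant quasi-coherent $\mathcal{O}_S$-module is a quasi-coherent $\mathcal{O}_S$-module $\mathcal{F}$ with a coaction $\mu_{\mathcal F}\colon \mathcal{F}\to \mathcal{O}_S[G]\otimes_{\mathcal{O}_S}\mathcal{F}$ which is $\mathcal{O}_S$-linear, counital and coassociative; these form the category $\mathsf{Qcoh}^G(S)$. The fixed subsheaf is $\mathcal{F}^G=\ker(1\otimes \mathrm{id}_{\mathcal F}-\mu_{\mathcal F})$. The module $\mathcal{O}_S[G]$ is viewed in $\mathsf{Qcoh}^G(S)$ via its comultiplication, and $\mathcal{O}_S$ has the trivial coaction. $G$ is linearly reductive if the unit morphism $\mathcal{O}_S\to\mathcal{O}_S[G]$ admits a retraction in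 $\mathsf{Qcoh}^G(S)$. $G$ has the resolution property if every $G$-equivariant coherent $\mathcal{O}_S$-module is a $G$-equivariant quotient of a $G$-equivariant $\mathcal{O}_S$-module which is locally free of finite rank. A $G$-equivariant vector bundle $V\to S$ is a vector bundle whose sheaf of sections $\mathcal V$ is a $G$-equivariant $\mathcal{O}_S$-module; $V^G=0$ means $\mathcal V^G=0$. A section of a $G$-equivariant vector bundle over $X$ is $G$-equivariant if it is so as a morphism of schemes. The vanishing locus of a section $s$ of a vector bundle over $X$ with sheaf of sections $\mathcal W$ is the closed subscheme of $X$ whose ideal is the image of $s^\vee\colon\mathcal{W}^\vee\to\mathcal{O}_X$. The fixed locus $X^G\subset X$ is the closed subscheme such that, for every $S$-scheme $T$, $X^G(T)\subset X(T)$ is the set of $S$-morphisms $T\to X$ which are $G$-equivariant for the trivial $G$-action on $T$. *)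

(* Defs.v *)
(* Affine schemes are handled through their coordinate rings.  The base is
   S = Spec A; an affine S-scheme is the spectrum of a commutative A-algebra, a
   morphism of affine S-schemes is an algebra morphism in the other direction,
   the fibre product over S is the tensor product over A, and a quasi-coherent
   O_S-module is an A-module.  The rings are comPzRingType, so that the empty
   scheme (the zero ring) is allowed. *)

From HB Require Import structures.
From mathcomp Require Import all_boot all_algebra.
From mathcomp Require Import boolp.

Set Implicit Arguments.
Unset Strict Implicit.
Unset Printing Implicit Defensive.

Import GRing.Theory.
Local Open Scope ring_scope.

Definition bilin (A : comPzRingType) (M N P : lmodType A) (f : M -> N -> P) :=
  (forall n, linear (f^~ n)) /\ (forall m, linear (f m)).

Section Tensor.
Variables (A : comPzRingType) (M N : lmodType A).

Definition fsum (P : lmodType A) (f : M -> N -> P) (s : seq (M * N)) : P :=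
  \sum_(x <- s) f x.1 x.2.

(* A formal sum of pairs stands for the corresponding sum of pure tensors; two
   formal sums are identified when no bilinear map tells them apart. *)
Definition tens_eqv (s t : seq (M * N)) : bool :=
  `[< forall (P : lmodType A) (f : M -> N -> P),
        bilin f -> fsum f s = fsum f t >].

Lemma tens_eqvP s t :
  reflect (forall (P : lmodType A) (f : M -> N -> P),
             bilin f -> fsum f s = fsum f t) (tens_eqv s t).
Proof. exact: asboolP. Qed.

Fact tens_eqv_refl : reflexive tens_eqv.
Proof. by move=> s; apply/tens_eqvP. Qed.

Fact tens_eqv_sym : symmetric tens_eqv.
Proof.
by move=> s t; apply/tens_eqvP/tens_eqvP => h P f hf; rewrite (h P f hf).
Qed.

Fact tens_eqv_trans : transitive tens_eqv.
Proof.
move=> t s u /tens_eqvP h1 /tens_eqvP h2; apply/tens_eqvP => P f hf.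
by rewrite (h1 P f hf) (h2 P f hf).
Qed.

Definition tens_rel : equiv_rel (seq (M * N)) :=
  EquivRel tens_eqv tens_eqv_refl tens_eqv_sym tens_eqv_trans.

Definition tens : Type := {eq_quot tens_rel}%qT.
HB.instance Definition _ := Choice.on tens.

Definition tcls (s : seq (M * N)) : tens := (\pi_({eq_quot tens_rel}%qT) s)%qT.
Definition trep (t : tens) : seq (M * N) :=
  repr (t : {eq_quot tens_rel}%qT).

Lemma trepK t : tcls (trep t) = t.
Proof. exact: reprK. Qed.

Lemma tclsP s t : reflect (tcls s = tcls t) (tens_eqv s t).
Proof. exact: (iffP (eqmodP tens_rel s t)). Qed.

Lemma fsum_trep (P : lmodType A) (f : M -> N -> P) s :
  bilin f -> fsum f (trep (tcls s)) = fsum f s.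
Proof.
move=> hf; have /tclsP/tens_eqvP h : tcls (trep (tcls s)) = tcls s.
  exact: trepK.
exact: h.
Qed.

Lemma tens_ext (t u : tens) :
  (forall (P : lmodType A) (f : M -> N -> P),
     bilin f -> fsum f (trep t) = fsum f (trep u)) -> t = u.
Proof. by move=> h; rewrite -[t]trepK -[u]trepK; apply/tclsP/tens_eqvP. Qed.

Lemma bilinDl (P : lmodType A) (f : M -> N -> P) m m' n :
  bilin f -> f (m + m') n = f m n + f m' n.
Proof. by case=> h _; have := h n 1 m m'; rewrite !scale1r. Qed.

Lemma bilinDr (P : lmodType A) (f : M -> N -> P) m n n' :
  bilin f -> f m (n + n') = f m n + f m n'.
Proof. by case=> _ h; have := h m 1 n n'; rewrite !scale1r. Qed.

Lemma bilin0l (P : lmodType A) (f : M -> N -> P) n : bilin f -> f 0 n = 0.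
Proof. by move=> hf; apply: (addrI (f 0 n)); rewrite -bilinDl // !addr0. Qed.

Lemma bilin0r (P : lmodType A) (f : M -> N -> P) m : bilin f -> f m 0 = 0.
Proof. by move=> hf; apply: (addrI (f m 0)); rewrite -bilinDr // !addr0. Qed.

Lemma bilinZl (P : lmodType A) (f : M -> N -> P) a m n :
  bilin f -> f (a *: m) n = a *: f m n.
Proof.
by move=> hf; have := hf.1 n a m 0; rewrite !addr0 bilin0l // addr0.
Qed.

Lemma bilinZr (P : lmodType A) (f : M -> N -> P) a m n :
  bilin f -> f m (a *: n) = a *: f m n.
Proof.
by move=> hf; have := hf.2 m a n 0; rewrite !addr0 bilin0r // addr0.
Qed.

Definition tadd (t u : tens) := tcls (trep t ++ trep u).
Definition tscale (a : A) (t : tens) :=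
  tcls [seq (a *: x.1, x.2) | x <- trep t].
Definition tzero := tcls [::].
Definition topp := tscale (- 1).

Lemma fsum_add (P : lmodType A) (f : M -> N -> P) t u : bilin f ->
  fsum f (trep (tadd t u)) = fsum f (trep t) + fsum f (trep u).
Proof. by move=> hf; rewrite fsum_trep // /fsum big_cat. Qed.

Lemma fsum_zero (P : lmodType A) (f : M -> N -> P) : bilin f ->
  fsum f (trep tzero) = 0.
Proof. by move=> hf; rewrite fsum_trep // /fsum big_nil. Qed.

Lemma fsum_scale (P : lmodType A) (f : M -> N -> P) a t : bilin f ->
  fsum f (trep (tscale a t)) = a *: fsum f (trep t).
Proof.
move=> hf; rewrite fsum_trep // /fsum big_map scaler_sumr.
by apply: eq_bigr => x _; rewrite bilinZl.
Qed.

Fact taddA : associative tadd.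
Proof. by move=> t u v; apply: tens_ext => P f hf; rewrite !fsum_add // addrA. Qed.

Fact taddC : commutative tadd.
Proof. by move=> t u; apply: tens_ext => P f hf; rewrite !fsum_add // addrC. Qed.

Fact tadd0 : left_id tzero tadd.
Proof.
by move=> t; apply: tens_ext => P f hf; rewrite fsum_add // fsum_zero ?add0r.
Qed.

Fact taddN : left_inverse tzero topp tadd.
Proof.
move=> t; apply: tens_ext => P f hf.
by rewrite fsum_add // fsum_zero // fsum_scale // scaleN1r addNr.
Qed.

HB.instance Definition _ := GRing.isZmodule.Build tens taddA taddC tadd0 taddN.

Fact tscaleA a b t : tscale a (tscale b t) = tscale (a * b) t.
Proof. by apply: tens_ext => P f hf; rewrite !fsum_scale // scalerA. Qed.

Fact tscale1 : left_id 1 tscale.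
Proof. by move=> t; apply: tens_ext => P f hf; rewrite fsum_scale // scale1r. Qed.

Fact tscaleDr : right_distributive tscale +%R.
Proof.
move=> a t u; apply: tens_ext => P f hf.
by rewrite fsum_scale // !fsum_add // !fsum_scale // scalerDr.
Qed.

Fact tscaleDl t : {morph tscale^~ t : a b / a + b}.
Proof.
move=> a b; apply: tens_ext => P f hf.
by rewrite fsum_add // !fsum_scale // scalerDl.
Qed.

HB.instance Definition _ :=
  GRing.Zmodule_isLmodule.Build A tens tscaleA tscale1 tscaleDr tscaleDl.

Definition tpure (m : M) (n : N) : tens := tcls [:: (m, n)].

Lemma tpure_bilin : bilin tpure.
Proof.
split=> [n a m m'|m a n n']; apply: tens_ext => P f hf;
  rewrite fsum_add // fsum_scale // !fsum_trep // /fsum !big_seq1 /=.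
- by rewrite bilinDl ?bilinZl.
- by rewrite bilinDr ?bilinZr.
Qed.

Lemma tcls_sum s : tcls s = \sum_(x <- s) tpure x.1 x.2.
Proof.
elim: s => [|x s IHs]; first by rewrite big_nil.
rewrite big_cons -IHs; apply: tens_ext => P f hf.
by rewrite fsum_add // !fsum_trep // /fsum big_cons big_seq1.
Qed.

Lemma tens_ind (Q : tens -> Prop) :
  Q 0 -> (forall m n, Q (tpure m n)) ->
  (forall t u, Q t -> Q u -> Q (t + u)) -> forall t, Q t.
Proof.
move=> h0 h1 hD t; rewrite -[t]trepK tcls_sum.
by elim/big_ind: _ => // x _; apply: h1.
Qed.

Section Lift.
Variables (P : lmodType A) (f : M -> N -> P) (hf : bilin f).

Definition tlift_fun of bilin f := fun t : tens => fsum f (trep t).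
Let g := tlift_fun hf.

Fact tlift_linear : linear g.
Proof. by move=> a t u; rewrite /g /tlift_fun fsum_add // fsum_scale. Qed.

HB.instance Definition _ :=
  GRing.isLinear.Build A tens P _ (tlift_fun hf) tlift_linear.

Definition tlift : {linear tens -> P} := tlift_fun hf.

Lemma tliftE m n : tlift (tpure m n) = f m n.
Proof. by rewrite /= /tlift_fun fsum_trep // /fsum big_seq1. Qed.
End Lift.

Lemma tens_linear_ext (P : lmodType A) (g h : {linear tens -> P}) :
  (forall m n, g (tpure m n) = h (tpure m n)) -> g =1 h.
Proof.
move=> e; apply: tens_ind => [|//|t u et eu]; first by rewrite !linear0.
by rewrite !linearD et eu.
Qed.

End Tensor.

Arguments tpure {A M N} m n.
Arguments tlift {A M N P f} hf.

Notation "m ⊗ n" := (tpure m n) (at level 40, left associativity) : ring_scope.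

Section TensorMaps.
Variable A : comPzRingType.

Fact tmap_bilin (M N M' N' : lmodType A)
  (f : {linear M -> M'}) (g : {linear N -> N'}) :
  bilin (fun m n => f m ⊗ g n).
Proof.
split=> [n a m m'|m a n n']; rewrite linearP.
- exact: (tpure_bilin M' N').1.
- exact: (tpure_bilin M' N').2.
Qed.

Definition tmap (M N M' N' : lmodType A)
  (f : {linear M -> M'}) (g : {linear N -> N'}) :
  {linear tens M N -> tens M' N'} := tlift (tmap_bilin f g).

Fact tunit_bilin (M : lmodType A) : bilin (fun (a : A^o) (m : M) => a *: m).
Proof.
split=> [m a b c|a b m m'].
- by rewrite scalerDl -scalerA.
- by rewrite scalerDr !scalerA mulrC.
Qed.

Definition tunit (M : lmodType A) : {linear tens A^o M -> M} :=
  tlift (tunit_bilin M).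

Fact tassoc_bilin1 (M N P : lmodType A) (p : P) :
  bilin (fun (m : M) (n : N) => m ⊗ (n ⊗ p)).
Proof.
split=> [n a m m'|m a n n'].
- exact: (tpure_bilin M _).1.
- by rewrite (tpure_bilin N P).1 (tpure_bilin M _).2.
Qed.

Fact tassoc_bilin (M N P : lmodType A) :
  bilin (fun (t : tens M N) (p : P) => tlift (tassoc_bilin1 M N p) t).
Proof.
split=> [p|t a p p']; first exact: linearP.
elim/tens_ind: t => [|m n|t u et eu].
- by rewrite !linear0 addr0.
- by rewrite !tliftE (tpure_bilin N P).2 (tpure_bilin M _).2.
- by rewrite !linearD et eu addrACA.
Qed.

Definition tassoc (M N P : lmodType A) :
  {linear tens (tens M N) P -> tens M (tens N P)} :=
  tlift (tassoc_bilin M N P).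

End TensorMaps.

(* The library's algebras over a ring are non-trivial by definition; calg also
   covers the zero algebra. *)
Record calg (A : comPzRingType) := CAlg {
  calg_mod : lmodType A;
  calg_one : calg_mod;
  calg_mul : calg_mod -> calg_mod -> calg_mod;
  calg_mulA : associative calg_mul;
  calg_mulC : commutative calg_mul;
  calg_mul1 : left_id calg_one calg_mul;
  calg_mulDl : left_distributive calg_mul +%R;
  calg_scaleAl : forall a x y, calg_mul (a *: x) y = a *: calg_mul x y
}.

Definition calg_sort (A : comPzRingType) (B : calg A) : Type := calg_mod B.
Coercion calg_sort : calg >-> Sortclass.

HB.instance Definition _ (A : comPzRingType) (B : calg A) :=
  GRing.Lmodule.copy (calg_sort B) (calg_mod B).
HB.instance Definition _ (A : comPzRingType) (B : calg A) :=
  GRing.Zmodule_isComPzRing.Build (calg_sort B)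
    (@calg_mulA A B) (@calg_mulC A B) (@calg_mul1 A B) (@calg_mulDl A B).

Section CAlgTheory.
Variables (A : comPzRingType) (B : calg A).

Lemma cscalerAl (a : A) (x y : B) : (a *: x) * y = a *: (x * y).
Proof. exact: calg_scaleAl. Qed.

Lemma cscalerAr (a : A) (x y : B) : x * (a *: y) = a *: (x * y).
Proof. by rewrite mulrC cscalerAl mulrC. Qed.

Fact cmul_bilin : bilin (fun x y : B => x * y).
Proof.
by split=> [y|x] a u v; rewrite ?mulrDl ?mulrDr ?cscalerAl ?cscalerAr.
Qed.

Definition cmul : {linear tens B B -> B} := tlift cmul_bilin.

End CAlgTheory.

Definition calg_self (A : comPzRingType) : calg A :=
  @CAlg A A^o 1 *%R (@mulrA A) (@mulrC A) (@mul1r A) (@mulrDl A)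
    (fun a x y => esym (mulrA a x y)).

Record ahom (A : comPzRingType) (B C : calg A) := AHom {
  ahom_lin :> {linear B -> C};
  ahom_mul : monoid_morphism ahom_lin
}.

Section AlgMorphisms.
Variable A : comPzRingType.

Fact ahom_comp_mul (B C D : calg A) (g : ahom C D) (f : ahom B C) :
  monoid_morphism (g \o f).
Proof.
split=> [|x y] /=; first by rewrite (ahom_mul f).1 (ahom_mul g).1.
by rewrite (ahom_mul f).2 (ahom_mul g).2.
Qed.

Definition ahom_comp (B C D : calg A) (g : ahom C D) (f : ahom B C) : ahom B D :=
  AHom (ahom_comp_mul g f).

Fact ahom_id_mul (B : calg A) : monoid_morphism (@idfun B).
Proof. by []. Qed.

Definition ahom_id (B : calg A) : ahom B B := AHom (ahom_id_mul B).

Section TensorAlg.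
Variables B C : calg A.

Fact tmul1_bilin (b : B) (c : C) :
  bilin (fun (b' : B) (c' : C) => (b * b') ⊗ (c * c')).
Proof.
split=> [c' a b1 b2|b' a c1 c2].
- by rewrite mulrDr cscalerAr (tpure_bilin B C).1.
- by rewrite mulrDr cscalerAr (tpure_bilin B C).2.
Qed.

Fact tmul_bilin (u : tens B C) :
  bilin (fun (b : B) (c : C) => tlift (tmul1_bilin b c) u).
Proof.
split=> [c a b1 b2|b a c1 c2]; elim/tens_ind: u => [|b' c'|u v eu ev];
  rewrite ?linear0 ?scaler0 ?addr0 // ?tliftE.
- by rewrite mulrDl cscalerAl (tpure_bilin B C).1.
- by rewrite !linearD eu ev addrACA.
- by rewrite mulrDl cscalerAl (tpure_bilin B C).2.
- by rewrite !linearD eu ev addrACA.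
Qed.

Definition tmul (t u : tens B C) : tens B C := tlift (tmul_bilin u) t.

Lemma tmulE b c b' c' : tmul (b ⊗ c) (b' ⊗ c') = (b * b') ⊗ (c * c').
Proof. by rewrite /tmul !tliftE. Qed.

Fact tmulDl : forall t u v, tmul (t + u) v = tmul t v + tmul u v.
Proof. by move=> t u v; rewrite /tmul linearD. Qed.

Fact tmulZl a t u : tmul (a *: t) u = a *: tmul t u.
Proof. by rewrite /tmul linearZ. Qed.

Fact tmulC : commutative tmul.
Proof.
have tmul0 t : tmul 0 t = 0 by rewrite /tmul linear0.
have tmul0r t : tmul t 0 = 0.
  elim/tens_ind: t => [//|b c|t u et eu].
  - by rewrite /tmul tliftE linear0.
  - by rewrite tmulDl et eu addr0.
have tmulDr t u v : tmul t (u + v) = tmul t u + tmul t v.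
  elim/tens_ind: t => [|b c|t w et ew]; first by rewrite !tmul0 addr0.
  - by rewrite /tmul !tliftE linearD.
  - by rewrite !tmulDl et ew addrACA.
move=> t u; elim/tens_ind: t => [|b c|t w et ew]; first by rewrite tmul0 tmul0r.
- elim/tens_ind: u => [|b' c'|u v eu ev]; first by rewrite tmul0 tmul0r.
  + by rewrite !tmulE mulrC [c * _]mulrC.
  + by rewrite tmulDr tmulDl eu ev.
- by rewrite tmulDl tmulDr et ew.
Qed.

Fact tmulA : associative tmul.
Proof.
have tmul0 t : tmul 0 t = 0 by rewrite /tmul linear0.
have tmul0r t : tmul t 0 = 0 by rewrite tmulC tmul0.
have tmulDr t u v : tmul t (u + v) = tmul t u + tmul t v.
  by rewrite tmulC tmulDl ![tmul _ t]tmulC.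
move=> t u v; elim/tens_ind: t => [|b c|t w et ew]; first by rewrite !tmul0.
  elim/tens_ind: u => [|b' c'|u w eu ew]; first by rewrite tmul0 tmul0r tmul0.
    elim/tens_ind: v => [|b'' c''|v w ev ew]; first by rewrite !tmul0r.
    - by rewrite !tmulE !mulrA.
    - by rewrite !tmulDr ev ew.
  by rewrite tmulDr !tmulDl tmulDr eu ew.
by rewrite !tmulDl et ew.
Qed.

Fact tmul1 : left_id ((1 : B) ⊗ (1 : C)) tmul.
Proof.
move=> t; elim/tens_ind: t => [|b c|t u et eu].
- by rewrite tmulC /tmul linear0.
- by rewrite tmulE !mul1r.
- by rewrite tmulC tmulDl ![tmul _ (_ ⊗ _)]tmulC et eu.
Qed.

Definition tens_alg : calg A :=
  CAlg tmulA tmulC tmul1 tmulDl tmulZl.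

End TensorAlg.

(* On spectra: the morphism T -> Y * Z with components T -> Y and T -> Z. *)
Section Pairing.
Variables (B C D : calg A) (f : ahom B D) (g : ahom C D).

Definition apair_lin : {linear tens B C -> D} := cmul D \o tmap f g.

Lemma apair_linE b c : apair_lin (b ⊗ c) = f b * g c.
Proof. by rewrite /= !tliftE. Qed.

Fact apair_mul : monoid_morphism (apair_lin : tens_alg B C -> D).
Proof.
split; first by rewrite [LHS]apair_linE (ahom_mul f).1 (ahom_mul g).1 mul1r.
move=> t u; rewrite -[t * u]/(tmul t u).
elim/tens_ind: t => [|b c|t v et ev].
- by rewrite /tmul !linear0 mul0r.
- elim/tens_ind: u => [|b' c'|u v eu ev].
  + by rewrite tmulC /tmul !linear0 mulr0.
  + by rewrite tmulE !apair_linE (ahom_mul f).2 (ahom_mul g).2 mulrACA.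
  + by rewrite tmulC tmulDl ![tmul _ (b ⊗ c)]tmulC !linearD eu ev mulrDr.
- by rewrite tmulDl !linearD et ev mulrDl.
Qed.

Definition apair : ahom (tens_alg B C) D :=
  @AHom A (tens_alg B C) D apair_lin apair_mul.

End Pairing.

End AlgMorphisms.

Section Algebra.

Definition finitely_generated (R : comPzRingType) (M : lmodType R) : Prop :=
  exists (n : nat) (e : 'I_n -> M),
    forall m, exists c : 'I_n -> R, m = \sum_i c i *: e i.

Definition noetherian (R : comPzRingType) : Prop :=
  forall I : R -> Prop,
    I 0 -> (forall x y, I x -> I y -> I (x + y)) ->
    (forall r x, I x -> I (r * x)) ->
    exists (n : nat) (e : 'I_n -> R), (forall i, I (e i)) /\
      forall x, I x -> exists c : 'I_n -> R, x = \sum_i c i * e i.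

Definition projective (R : comPzRingType) (M : lmodType R) : Prop :=
  forall (P Q : lmodType R) (p : {linear P -> Q}) (f : {linear M -> Q}),
    (forall q, exists x, p x = q) ->
    exists h : {linear M -> P}, forall m, p (h m) = f m.

Definition free_of_finite_rank (R : comPzRingType) (M : lmodType R) : Prop :=
  exists (n : nat) (f : {linear 'rV[R]_n -> M}), bijective f.

(* phi : R -> R' is the localization R -> R[1/f]. *)
Definition is_localization (R R' : comPzRingType) (phi : R -> R') (f : R) : Prop :=
  [/\ exists u, phi f * u = 1,
      forall y, exists (k : nat) (x : R), phi f ^+ k * y = phi x
    & forall x, phi x = 0 -> exists k : nat, f ^+ k * x = 0].

Variable A : comPzRingType.

Definition finite_type (B : calg A) : Prop :=
  exists s : seq B, forall P : B -> Prop,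
    (forall a : A, P (a *: (1 : B))) -> (forall x, x \in s -> P x) ->
    (forall x y, P x -> P y -> P (x + y)) ->
    (forall x y, P x -> P y -> P (x * y)) ->
    forall x, P x.

Fact ahom_str_linear (B : calg A) : linear (fun a : A^o => a *: (1 : B)).
Proof. by move=> a x y; rewrite scalerDl -scalerA. Qed.

Definition ahom_str_fun (B : calg A) (a : calg_self A) : B := (a : A) *: (1 : B).
HB.instance Definition _ (B : calg A) :=
  GRing.isLinear.Build A (calg_self A) B _ (@ahom_str_fun B)
    (@ahom_str_linear B).

Fact ahom_str_mul (B : calg A) : monoid_morphism (@ahom_str_fun B).
Proof.
split=> [|x y]; first exact: scale1r.
by rewrite /ahom_str_fun cscalerAl mul1r scalerA.
Qed.

(* The structure morphism Spec B -> Spec A. *)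
Definition ahom_str (B : calg A) : ahom (calg_self A) B :=
  @AHom A (calg_self A) B (@ahom_str_fun B) (ahom_str_mul B).

Section BaseChange.
Variables (R : calg A) (M : lmodType A).

Definition bchange : Type := tens R M.
HB.instance Definition _ := GRing.Zmodule.on bchange.

Fact cmull_linear (r : R) : linear (fun x : R => r * x).
Proof. exact: (cmul_bilin R).2. Qed.

Definition cmull (r : R) (x : R) : R := r * x.
HB.instance Definition _ (r : R) :=
  GRing.isLinear.Build A R R _ (cmull r) (cmull_linear r).

Definition bscale (r : R) (t : bchange) : bchange := tmap (cmull r) idfun t.

Lemma bscaleE r x m : bscale r (x ⊗ m) = (r * x) ⊗ m.
Proof. by rewrite /bscale [LHS]tliftE. Qed.

Fact bscaleDr : right_distributive bscale +%R.
Proof. by move=> r t u; rewrite /bscale; apply: linearD. Qed.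

Fact bscale0r r : bscale r 0 = 0.
Proof. exact: (linear0 (tmap (cmull r) idfun)). Qed.

Lemma bchange_ind (Q : bchange -> Prop) :
  Q 0 -> (forall r m, Q ((r : R) ⊗ m)) ->
  (forall t u, Q t -> Q u -> Q (t + u)) -> forall t, Q t.
Proof. exact: tens_ind. Qed.

Fact bscaleA r r' t : bscale r (bscale r' t) = bscale (r * r') t.
Proof.
elim/bchange_ind: t => [|x m|t u et eu]; first by rewrite !bscale0r.
- by rewrite !bscaleE mulrA.
- by rewrite !bscaleDr et eu.
Qed.

Fact bscale1 : left_id 1 bscale.
Proof.
move=> t; elim/bchange_ind: t => [|x m|t u et eu]; first by rewrite bscale0r.
- by rewrite bscaleE mul1r.
- by rewrite bscaleDr et eu.
Qed.

Fact bscaleDl t : {morph bscale^~ t : r r' / r + r'}.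
Proof.
move=> r r'; elim/bchange_ind: t => [|x m|t u et eu].
- by rewrite !bscale0r addr0.
- by rewrite !bscaleE mulrDl (bilinDl _ _ _ (tpure_bilin R M)).
- by rewrite !bscaleDr et eu addrACA.
Qed.

(* bchange R M is R ⊗_A M as an R-module. *)
HB.instance Definition _ :=
  GRing.Zmodule_isLmodule.Build R bchange bscaleA bscale1 bscaleDr bscaleDl.

End BaseChange.

Definition bmap (M : lmodType A) (R R' : calg A) (x : ahom R R') :
  bchange R M -> bchange R' M := tmap x idfun.

(* Spec A' -> Spec A is an open immersion: Spec A' is covered by preimages of
   basic opens D(f i) over each of which the map is an isomorphism. *)
Definition affine_open (A' : calg A) : Prop :=
  exists (n : nat) (f : 'I_n -> A),
    (exists c : 'I_n -> A', \sum_i c i * ahom_str A' (f i) = 1) /\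
    forall i, exists (L : calg A) (phi : ahom A' L),
      is_localization (ahom_str L : A -> L) (f i) /\
      is_localization phi (ahom_str A' (f i)).

Definition locally_projective (M : lmodType A) : Prop :=
  forall A' : calg A, affine_open A' -> projective (bchange A' M).

Definition locally_free_of_finite_rank (M : lmodType A) : Prop :=
  exists (n : nat) (f : 'I_n -> A),
    (exists c : 'I_n -> A, \sum_i c i * f i = 1) /\
    forall i, exists L : calg A,
      is_localization (ahom_str L : A -> L) (f i) /\
      free_of_finite_rank (bchange L M).

End Algebra.

(* An affine group scheme Spec H over Spec A, as a commutative Hopf algebra. *)
Record agroup (A : comPzRingType) := AGroup {
  ag_alg :> calg A;
  ag_mul : ahom ag_alg (tens_alg ag_alg ag_alg);
  ag_unit : ahom ag_alg (calg_self A);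
  ag_inv : ahom ag_alg ag_alg;
  ag_mulA : forall h, tassoc _ _ _ (tmap ag_mul idfun (ag_mul h))
                      = tmap idfun ag_mul (ag_mul h);
  ag_mul1l : forall h,
    apair (ahom_comp (ahom_str ag_alg) ag_unit) (ahom_id ag_alg) (ag_mul h) = h;
  ag_mul1r : forall h,
    apair (ahom_id ag_alg) (ahom_comp (ahom_str ag_alg) ag_unit) (ag_mul h) = h;
  ag_mulVl : forall h, apair ag_inv (ahom_id ag_alg) (ag_mul h)
                       = ahom_str ag_alg (ag_unit h);
  ag_mulVr : forall h, apair (ahom_id ag_alg) ag_inv (ag_mul h)
                       = ahom_str ag_alg (ag_unit h)
}.

Section Equivariant.
Variables (A : comPzRingType) (G : agroup A).

Definition is_coaction (M : lmodType A) (mu : {linear M -> tens G M}) : Prop :=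
  (forall m, tassoc _ _ _ (tmap (ag_mul G) idfun (mu m))
             = tmap idfun mu (mu m)) /\
  (forall m, tunit M (tmap (ag_unit G) idfun (mu m)) = m).

Record gmod := GMod {
  gm_mod :> lmodType A;
  gm_coact : {linear gm_mod -> tens G gm_mod};
  gm_coactP : is_coaction gm_coact
}.

Definition equivariant (M N : gmod) (f : {linear M -> N}) : Prop :=
  forall m, gm_coact N (f m) = tmap idfun f (gm_coact M m).

(* The kernel of 1 ⊗ id - mu. *)
Definition gm_fixed (M : gmod) (m : M) : Prop := (1 : G) ⊗ m - gm_coact M m = 0.

Fact reg_coactP : @is_coaction G (ag_mul G : {linear G -> tens_alg G G}).
Proof.
split=> h; first exact: ag_mulA.
rewrite -[RHS](ag_mul1l h); move: (ag_mul G h : tens G G).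
apply: (@tens_linear_ext A G G G (tunit G \o tmap (ag_unit G) idfun)
          (apair_lin (ahom_comp (ahom_str G) (ag_unit G)) (ahom_id G))) => x y.
by rewrite [LHS]/= [RHS]apair_linE !tliftE /= /ahom_str_fun cscalerAl mul1r.
Qed.

Definition reg_gmod : gmod := GMod reg_coactP.

Definition triv_coact_fun (M : lmodType A) (m : M) : tens G M := (1 : G) ⊗ m.
HB.instance Definition _ (M : lmodType A) :=
  GRing.isLinear.Build A M (tens G M) _ (@triv_coact_fun M)
    ((tpure_bilin G M).2 1).
Definition triv_coact (M : lmodType A) : {linear M -> tens G M} :=
  @triv_coact_fun M.

Fact triv_coactP (M : lmodType A) : is_coaction (triv_coact M).
Proof.
split=> m; rewrite /= /triv_coact_fun !tliftE.
- by rewrite (ahom_mul (ag_mul G)).1 [LHS]tliftE.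
- by rewrite (ahom_mul (ag_unit G)).1 scale1r.
Qed.

Definition triv_gmod (M : lmodType A) : gmod := GMod (triv_coactP M).

Definition linearly_reductive : Prop :=
  exists r : {linear reg_gmod -> triv_gmod A^o},
    equivariant r /\ forall a : A, r (ahom_str G a) = a.

(* Over a noetherian base, coherent means finitely generated. *)
Definition resolution_property : Prop :=
  forall M : gmod, finitely_generated M ->
    exists (E : gmod) (p : {linear E -> M}),
      [/\ locally_free_of_finite_rank E, equivariant p
        & forall m, exists e, p e = m].

(* Spec B with a left action of G; the coaction B -> A[G] ⊗ B is the comorphism
   of the action G * X -> X. *)
Record gscheme := GScheme {
  gs_alg :> calg A;
  gs_act : ahom gs_alg (tens_alg G gs_alg);
  gs_actP : @is_coaction gs_alg (gs_act : {linear gs_alg -> tens_alg G gs_alg})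
}.

(* The point g . x of X(R) = Hom(B, R), for g in G(R) and x in X(R). *)
Definition act_pt (X : gscheme) (R : calg A) (g : ahom G R) (x : ahom X R) :
  ahom X R := ahom_comp (apair g x) (gs_act X).

(* x, a morphism Spec T -> X, is equivariant for the trivial action on Spec T;
   equivariance is tested on points with values in all A-algebras. *)
Definition fixed_pt (X : gscheme) (T : calg A) (x : ahom X T) : Prop :=
  forall (R : calg A) (g : ahom G R) (t : ahom T R),
    act_pt g (ahom_comp t x) =1 ahom_comp t x.

(* A morphism from an arbitrary S-scheme factors through a closed subscheme, or
   is equivariant, if and only if it is so on the members of an affine cover;
   hence affine test schemes Spec T suffice. *)
Definition is_fixed_locus (X : gscheme) (I : X -> Prop) : Prop :=
  forall (T : calg A) (x : ahom X T),
    (forall b, I b -> x b = 0) <-> fixed_pt x.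

Section VectorBundle.
Variables (V : gmod) (R : calg A).

Fact gm_ract_bilin (g : ahom G R) :
  @bilin A R V (tens R V)
    (fun r v => bscale r (tmap g idfun (gm_coact V v))).
Proof.
split=> [v a r r'|r a v v']; last by rewrite /bscale !linearP.
rewrite bscaleDl; congr (_ + _).
elim/bchange_ind: (tmap g idfun _ : bchange R V) => [|x m|t u et eu].
- by rewrite !bscale0r [RHS](scaler0 (tens R V)).
- by rewrite !bscaleE cscalerAl (bilinZl _ _ _ (tpure_bilin R V)).
- by rewrite !bscaleDr et eu [RHS](@scalerDr A (tens R V)).
Qed.

(* The coaction makes G(R) act R-linearly on V(R) = R ⊗ V by
   v |-> (g ⊗ id) (mu v); this is a right action, since mu is a left
   coaction. *)
Definition gm_ract (g : ahom G R) : bchange R V -> bchange R V :=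
  tlift (gm_ract_bilin g).

(* The left action of G on the total space of the vector bundle with sheaf of
   sections V, whose R-points are R ⊗ V. *)
Definition gm_act (g : ahom G R) : bchange R V -> bchange R V :=
  gm_ract (ahom_comp g (ag_inv G)).

End VectorBundle.

(* A section s of the pullback of V to X is an element of B ⊗ V; as a morphism
   X -> V it sends x in X(R) to the image of s in V(R) = R ⊗ V. *)
Definition equivariant_section (X : gscheme) (V : gmod) (s : bchange X V) : Prop :=
  forall (R : calg A) (g : ahom G R) (x : ahom X R),
    bmap (act_pt g x) s = gm_act g (bmap x s).

End Equivariant.

(* The image of the dual of s, from the dual of W to B. *)
Definition vanishing_ideal (B : comPzRingType) (W : lmodType B) (s : W) :
  B -> Prop :=
  fun b => exists phi : {linear W -> B^o}, phi s = b.

(* Main.v *)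
(* Reynolds operator: rho = (r ⊗ id) mu on B = O(X), with r : A[G] -> A the
   retraction.  A point x of X is fixed if and only if it kills the ideal I
   generated by the elements b - rho b.  As B is noetherian, finitely many b
   suffice; they lie in a coherent subcomodule of B (here A[G] is projective),
   hence in the image of an equivariant map p : E -> B with E locally free of
   finite rank.  A dual system of E turns the coaction into a matrix C over A[G]
   with Delta(C_ij) = sum_k C_ik ⊗ C_kj (a "comatrix") and mu(b) = C ⊗ b for the
   column b of the images of the generators of E.

   The rest is matrix algebra.  A comatrix C acts, through its rows, on the image
   of the idempotent e = eps(C); the matrix R = r(C) satisfies R C = C R = R, so
   C' = C - R is again a comatrix, with r(C') = 0, and C'_ij describes the coaction
   on the elements b_i - rho b_i, which generate I.  The comodule V dual to C', with
   comatrix the transpose of S(C'), has no fixed vector because r vanishes on its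
   comatrix, and sum_i (b_i - rho b_i) ⊗ (dual generator i) is an equivariant section
   whose vanishing ideal is I. *)

Require Import Defs.
From HB Require Import structures.
From mathcomp Require Import all_boot all_algebra.
From mathcomp Require Import perm boolp functions zify.

Set Implicit Arguments.
Unset Strict Implicit.
Unset Printing Implicit Defensive.

Import GRing.Theory.
Local Open Scope ring_scope.

(** * Submodules and tensor products *)

Section Submodule.
Variables (A : comPzRingType) (M : lmodType A).

Record submodule := Submodule {
  sm_pred :> M -> Prop;
  sm0 : sm_pred 0;
  smP : forall a x y, sm_pred x -> sm_pred y -> sm_pred (a *: x + y)
}.

(** Submodules are [Prop]-valued; classical decidability turns them into boolean predicates, so that
    [smod] inherits its module structure as a subtype. *)
Definition sm_mem (N : submodule) : pred M := fun x => `[< N x >].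

Fact sm_mem_closed (N : submodule) : submod_closed (sm_mem N).
Proof.
split=> [|a x y /asboolP Nx /asboolP Ny]; apply/asboolP; first exact: sm0.
exact: smP.
Qed.

HB.instance Definition _ (N : submodule) :=
  GRing.isSubmodClosed.Build A M (sm_mem N) (sm_mem_closed N).

Record smod (N : submodule) := SMod { smval : M; smvalP : sm_mem N smval }.
HB.instance Definition _ N := [isSub for @smval N].
HB.instance Definition _ N := [Choice of smod N by <:].
HB.instance Definition _ N := [SubChoice_isSubLmodule of smod N by <:].

Definition smincl (N : submodule) : {linear smod N -> M} := val.

Lemma sminclP (N : submodule) (x : smod N) : N (smincl N x).
Proof. by apply/asboolP/smvalP. Qed.

Definition smin (N : submodule) x (Nx : N x) : smod N := SMod (asboolT Nx).

Lemma sminK (N : submodule) x (Nx : N x) : smincl N (smin Nx) = x.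
Proof. by []. Qed.

Lemma smincl_inj (N : submodule) : injective (smincl N).
Proof. exact: val_inj. Qed.

End Submodule.

Section AhomMorphism.
Variables (A : comPzRingType) (B C : calg A).

(** Repackaging as a ring morphism makes the general lemmas on ring morphisms and on [map_mx]
    applicable. *)
Definition amorph (f : ahom B C) : {rmorphism B -> C} :=
  HB.pack (f : B -> C) (GRing.isZmodMorphism.Build B C f (raddfB f))
    (GRing.isMonoidMorphism.Build B C f (ahom_mul f)).

Lemma ahom1 (f : ahom B C) : f 1 = 1. Proof. exact: rmorph1 (amorph f). Qed.

Lemma ahomM (f : ahom B C) : {morph f : x y / x * y}.
Proof. exact: rmorphM (amorph f). Qed.

End AhomMorphism.


Definition mklin (R : comPzRingType) (M N : lmodType R) (f : M -> N) (hf : linear f) :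
  {linear M -> N} := HB.pack f (GRing.isLinear.Build R M N _ f hf).

(** * Dual systems and contractions of tensors *)

Section DualSystems.
Variables (A : comPzRingType).

Fact tevl_bilin (M N : lmodType A) (phi : {linear N -> A^o}) :
  bilin (fun (m : M) (n : N) => (phi n : A) *: m).
Proof.
split=> [n a m m'|m a n n'].
- by rewrite scalerDr !scalerA mulrC.
- by rewrite linearP scalerDl -scalerA.
Qed.

(** The last letter of [tevl] and [tevr] names the tensor factor that survives the contraction. *)
Definition tevl (M N : lmodType A) (phi : {linear N -> A^o}) :
  {linear tens M N -> M} := tlift (tevl_bilin M phi).

Lemma tevlE (M N : lmodType A) (phi : {linear N -> A^o}) (m : M) n :
  tevl M phi (m ⊗ n) = (phi n : A) *: m.
Proof. exact: tliftE. Qed.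

Definition tevr (M N : lmodType A) (psi : {linear M -> A^o}) :
  {linear tens M N -> N} := tunit N \o tmap psi idfun.

Lemma tevrE (M N : lmodType A) (psi : {linear M -> A^o}) m (n : N) :
  tevr N psi (m ⊗ n) = (psi m : A) *: n.
Proof. by rewrite [LHS]/= !tliftE. Qed.

Lemma tmapE (M N M' N' : lmodType A) (f : {linear M -> M'}) (g : {linear N -> N'}) m n :
  tmap f g (m ⊗ n) = f m ⊗ g n.
Proof. exact: tliftE. Qed.

Lemma tunitE (M : lmodType A) (a : A^o) (m : M) : tunit M (a ⊗ m) = (a : A) *: m.
Proof. exact: tliftE. Qed.

Lemma tassocE (M N P : lmodType A) (m : M) (n : N) (p : P) :
  tassoc M N P (m ⊗ n ⊗ p) = m ⊗ (n ⊗ p).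
Proof. by rewrite [LHS]tliftE tliftE. Qed.

Lemma tpure0l (M N : lmodType A) (n : N) : (0 : M) ⊗ n = 0.
Proof. exact: (bilin0l _ (tpure_bilin M N)). Qed.

Lemma tpureDl (M N : lmodType A) (m m' : M) (n : N) : (m + m') ⊗ n = m ⊗ n + m' ⊗ n.
Proof. exact: (bilinDl _ _ _ (tpure_bilin M N)). Qed.

Lemma tpureZl (M N : lmodType A) a (m : M) (n : N) : (a *: m) ⊗ n = a *: (m ⊗ n).
Proof. exact: (bilinZl _ _ _ (tpure_bilin M N)). Qed.

Lemma tpureDr (M N : lmodType A) (m : M) (n n' : N) : m ⊗ (n + n') = m ⊗ n + m ⊗ n'.
Proof. exact: (bilinDr _ _ _ (tpure_bilin M N)). Qed.

Lemma tpure0r (M N : lmodType A) (m : M) : m ⊗ (0 : N) = 0.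
Proof. exact: (bilin0r _ (tpure_bilin M N)). Qed.

Lemma tpureBl (M N : lmodType A) (m m' : M) (n : N) :
  (m - m') ⊗ n = m ⊗ n - m' ⊗ n.
Proof. by rewrite -scaleN1r tpureDl tpureZl scaleN1r. Qed.

Lemma tpureZ (M N : lmodType A) a (m : M) (n : N) : (a *: m) ⊗ n = m ⊗ (a *: n).
Proof.
by rewrite (bilinZl _ _ _ (tpure_bilin M N)) (bilinZr _ _ _ (tpure_bilin M N)).
Qed.

Lemma tpure_suml (M N : lmodType A) I (r : seq I) (F : I -> M) (n : N) :
  (\sum_(i <- r) F i) ⊗ n = \sum_(i <- r) F i ⊗ n.
Proof.
elim: r => [|x r IH]; first by rewrite !big_nil (bilin0l _ (tpure_bilin M N)).
by rewrite !big_cons (bilinDl _ _ _ (tpure_bilin M N)) IH.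
Qed.

Lemma tpure_sumr (M N : lmodType A) I (r : seq I) (F : I -> N) (m : M) :
  m ⊗ (\sum_(i <- r) F i) = \sum_(i <- r) m ⊗ F i.
Proof.
elim: r => [|x r IH]; first by rewrite !big_nil (bilin0r _ (tpure_bilin M N)).
by rewrite !big_cons (bilinDr _ _ _ (tpure_bilin M N)) IH.
Qed.

Lemma tpureBr (M N : lmodType A) (m : M) (n n' : N) :
  m ⊗ (n - n') = m ⊗ n - m ⊗ n'.
Proof. by rewrite -scaleN1r tpureDr -tpureZ tpureZl scaleN1r. Qed.

(** The list stands for an element of the dual of [M] tensored with [M], and [dual_sum] is the
    endomorphism of [M] that it defines. *)
Definition dual_sum (M : lmodType A) (s : seq ({linear M -> A^o} * M)) x : M :=
  \sum_(y <- s) (y.1 x : A) *: y.2.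

Lemma dual_sum_linear (M : lmodType A) s : linear (@dual_sum M s).
Proof.
move=> a x y; rewrite /dual_sum scaler_sumr -big_split /=.
by apply: eq_bigr => z _; rewrite linearP scalerDl -scalerA.
Qed.

(** By the dual basis lemma these are the finitely generated projective modules. *)
Definition dualizable (M : lmodType A) := exists s, forall x : M, dual_sum s x = x.

(** The list [s] may depend on [l], so projective modules of infinite rank are covered as well; this
    is the form in which projectivity of [G] is used. *)
Definition locally_dualizable (M : lmodType A) :=
  forall l : seq M, exists s, forall x, x \in l -> dual_sum s x = x.

Lemma tens_dual_r (M N : lmodType A) s (t : tens M N) :
  (forall x, dual_sum s x = x) -> t = \sum_(y <- s) tevl M y.1 t ⊗ y.2.
Proof.
move=> hs; elim/tens_ind: t => [|m n|t u et eu].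
- rewrite big1 // => y _; rewrite linear0; exact: (bilin0l _ (tpure_bilin M N)).
- rewrite -[in LHS](hs n) tpure_sumr; apply: eq_bigr => y _.
  by rewrite tevlE tpureZ.
- rewrite {1}et {1}eu -big_split; apply: eq_bigr => y _ /=.
  by rewrite linearD (bilinDl _ _ _ (tpure_bilin M N)).
Qed.

(** A tensor has only finitely many left factors in a chosen representative, so a dual system valid
    on these is enough. *)
Lemma tens_dual_l (M N : lmodType A) (t : tens M N) : locally_dualizable M ->
  exists s : seq ({linear M -> A^o} * M), t = \sum_(y <- s) y.2 ⊗ tevr N y.1 t.
Proof.
case/(_ [seq x.1 | x <- trep t]) => s hs; exists s.
rewrite -[in LHS](trepK t) tcls_sum.
have {2}-> : t = \sum_(x <- trep t) x.1 ⊗ x.2 by rewrite -tcls_sum trepK.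
under [RHS]eq_bigr => y _ do rewrite (linear_sum (tevr N y.1)) tpure_sumr.
rewrite exchange_big; apply: eq_big_seq => x xt.
rewrite -[in LHS](hs x.1) ?map_f // tpure_suml; apply: eq_bigr => y _.
by rewrite tevrE tpureZ.
Qed.

End DualSystems.

(** * Projective modules have local dual systems *)

Lemma eq_big_uniq_support (M : zmodType) (I : eqType) (s t : seq I) (F : I -> M) :
  uniq s -> uniq t -> (forall x, x \notin t -> F x = 0) ->
  (forall x, x \notin s -> F x = 0) -> \sum_(x <- s) F x = \sum_(x <- t) F x.
Proof.
move=> us ut ht hs; rewrite (bigID (mem t)) /= [X in _ + X]big1 ?addr0 //.
rewrite [RHS](bigID (mem s)) /= [X in _ = _ + X]big1 ?addr0 //.
rewrite -big_filter -[RHS]big_filter; apply: perm_big; apply: uniq_perm;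
  rewrite ?filter_uniq //.
by move=> x; rewrite !mem_filter andbC.
Qed.

Section Projective.
Variable A : comPzRingType.

Section FreeCover.
Variable M : lmodType A.

Fact finsupp0 : exists s : seq M, forall x, x \notin s -> (0 : M -> A^o) x = 0.
Proof. by exists [::]. Qed.

Fact finsuppP (a : A) (f g : M -> A^o) :
  (exists s : seq M, forall x, x \notin s -> f x = 0) ->
  (exists s : seq M, forall x, x \notin s -> g x = 0) ->
  exists s : seq M, forall x, x \notin s -> (a *: f + g) x = 0.
Proof.
move=> [s hs] [t ht]; exists (s ++ t) => x; rewrite mem_cat negb_or => /andP[xs xt].
suff: a * f x + g x = 0 :> A by [];
  rewrite (hs _ xs : f x = 0 :> A) (ht _ xt : g x = 0 :> A).
by rewrite mulr0 addr0.
Qed.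

(** The free module on the underlying set of [M], realized as finitely supported functions. *)
Definition finsupp : submodule (M -> A^o) := Submodule finsupp0 finsuppP.

Definition supp (f : smod finsupp) : seq M := undup (sval (cid (sminclP f))).

Lemma suppP f x : x \notin supp f -> smincl finsupp f x = 0.
Proof. by rewrite mem_undup => /(svalP (cid (sminclP f))). Qed.

Definition free_cover_fun (f : smod finsupp) : M :=
  \sum_(x <- supp f) (smincl finsupp f x : A) *: x.

(** The support [supp f] is chosen and may contain zeros of [f]; any other duplicate-free list
    outside which [f] vanishes gives the same sum. Linearity needs this, since the supports of [f],
    [g] and [a *: f + g] are chosen independently. *)
Lemma free_cover_funE f s : uniq s -> (forall x, x \notin s -> smincl finsupp f x = 0) ->
  free_cover_fun f = \sum_(x <- s) (smincl finsupp f x : A) *: x.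
Proof.
move=> us hs; apply: eq_big_uniq_support => // [|x /hs ->|x /suppP ->].
- exact: undup_uniq.
- by rewrite scale0r.
- by rewrite scale0r.
Qed.

Fact free_cover_linear : linear free_cover_fun.
Proof.
move=> a f g; pose s := undup (supp f ++ supp g).
have us : uniq s by exact: undup_uniq.
have hf x : x \notin s -> smincl finsupp f x = 0.
  by rewrite mem_undup mem_cat negb_or => /andP[/suppP].
have hg x : x \notin s -> smincl finsupp g x = 0.
  by rewrite mem_undup mem_cat negb_or => /andP[_ /suppP].
have e x : smincl finsupp (a *: f + g) x = a *: smincl finsupp f x + smincl finsupp g x.
  by rewrite linearP.
rewrite (free_cover_funE us hf) (free_cover_funE us hg) (@free_cover_funE _ s) //;
  last first.
  by move=> x xs; rewrite e hf // hg // scaler0 addr0.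
rewrite scaler_sumr -big_split; apply: eq_bigr => x _.
by rewrite e /= scalerDl -scalerA.
Qed.

HB.instance Definition _ := GRing.isLinear.Build A (smod finsupp) M _ free_cover_fun
  free_cover_linear.

Definition free_cover : {linear smod finsupp -> M} := free_cover_fun.

Lemma free_cover_surj x : exists f, free_cover f = x.
Proof.
have Nx : finsupp (fun y => (y == x)%:R : A^o).
  by exists [:: x] => y; rewrite inE => /negPf ->.
exists (smin Nx); rewrite [LHS](@free_cover_funE _ [:: x]) //.
- by rewrite big_seq1 sminK eqxx scale1r.
- by move=> y; rewrite inE sminK => /negPf ->.
Qed.

Fact free_coord_linear (h : {linear M -> smod finsupp}) x :
  linear (fun m => smincl finsupp (h m) x : A^o).
Proof. by move=> a m n; rewrite !linearP. Qed.

Definition free_coord (h : {linear M -> smod finsupp}) x : {linear M -> A^o} :=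
  mklin (free_coord_linear h x).

(** The coordinates of the splitting are the functionals, paired with the elements of [M] that index
    them; a finite list [l] meets only finitely many of these indices. *)
Lemma split_locally_dualizable (h : {linear M -> smod finsupp}) :
  (forall m, free_cover (h m) = m) -> locally_dualizable M.
Proof.
move=> hh l; pose s := undup (flatten [seq supp (h m) | m <- l]).
exists [seq (free_coord h x, x) | x <- s] => m ml.
rewrite /dual_sum big_map -[RHS]hh; symmetry; apply: free_cover_funE.
  exact: undup_uniq.
move=> x; rewrite mem_undup => hx; apply: suppP; apply: contra hx => hx.
by apply/flattenP; exists (supp (h m)) => //; apply: map_f.
Qed.

End FreeCover.

Lemma affine_open_self : affine_open (calg_self A).
Proof.
exists 1, (fun=> 1); split.
  by exists (fun=> 1); rewrite big_ord1 mul1r (ahom1 (ahom_str _)).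
move=> _; exists (calg_self A), (ahom_id _); split; split => //.
- by exists 1; rewrite (ahom1 (ahom_str _)) mul1r.
- move=> y; exists 0, (y : A); rewrite expr0 mul1r.
  by rewrite /= /ahom_str_fun; apply: esym; apply: mulr1.
- by move=> x xx; exists 0; rewrite expr0 mul1r -xx; apply: esym; apply: mulr1.
- by exists 1; rewrite /= (ahom1 (ahom_str _)) mul1r.
- by move=> y; exists 0, y; rewrite expr0 mul1r.
- by move=> x xx; exists 0; rewrite expr0 mul1r.
Qed.

Fact bmap_id_linear (M N : lmodType A) (R : calg A) (p : {linear M -> N}) :
  linear (tmap idfun p : bchange R M -> bchange R N).
Proof.
move=> a t u; rewrite [LHS]linearD; congr (_ + _).
change (tmap idfun p (bscale a t) = bscale a (tmap idfun p t : bchange R N)).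
elim/bchange_ind: t => [|r m|t v et ev].
- by rewrite bscale0r linear0 [RHS]bscale0r.
- by rewrite bscaleE [LHS]tliftE [X in _ = bscale _ X]tliftE [RHS]bscaleE.
- rewrite bscaleDr [LHS]linearD et ev; rewrite [in RHS](linearD (tmap idfun p)).
  exact: esym (bscaleDr _ _ _).
Qed.

(** Local projectivity is applied to the affine open [S] itself, where it splits the base change of
    the free cover. The splitting is then carried from [A ⊗ M] back to [M]. *)
Lemma locally_projective_dualizable (M : lmodType A) :
  locally_projective M -> locally_dualizable M.
Proof.
move=> /(_ _ affine_open_self) pM; pose R := calg_self A.
pose P := smod (finsupp M).
pose p : {linear bchange R P -> bchange R M} :=
  mklin (@bmap_id_linear _ _ R (free_cover M)).
have ps q : exists x, p x = q.
  elim/bchange_ind: q => [|r m|t u [x ex] [y ey]].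
  - by exists 0; rewrite linear0.
  - have [f ef] := free_cover_surj m.
    exists (r ⊗ f : bchange R P); rewrite [LHS]tliftE /=.
    by rewrite -ef.
  - by exists (x + y); rewrite linearD ex ey.
have [h hh] := pM _ _ p idfun ps.
have hZ (r : R) t : h (bscale r t) = bscale r (h t) by exact: linearZZ.
(* The module structure of [bchange R P] is over [R], a copy of [A]; this compares it with the
   [A]-structure of [P]. *)
have uZ (a : A) (u : bchange R P) : tunit P (bscale (a *: (1 : R)) u) = a *: tunit P u.
  elim/bchange_ind: u => [|r m|t u et eu].
  - by rewrite bscale0r linear0 scaler0.
  - rewrite bscaleE cscalerAl mul1r (bilinZl _ _ _ (tpure_bilin R P)).
    by rewrite linearZ.
  - by rewrite bscaleDr (linearD (tunit P)) et eu -scalerDr -(linearD (tunit P)).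
have h1 : linear (fun m : M => tunit P (h ((1 : R) ⊗ m))).
  move=> a x y; rewrite (tpure_bilin R M).2 -uZ -hZ bscaleE cscalerAl mulr1.
  rewrite (bilinZl _ _ _ (tpure_bilin R M)) -(linearD (tunit P)); congr (tunit P _).
  exact: (linearD h).
pose h' : {linear M -> P} := mklin h1.
apply: (@split_locally_dualizable _ h') => m.
have e : free_cover M \o tunit P =1 tunit M \o tmap (@idfun R) (free_cover M).
  by apply: tens_linear_ext => r f; rewrite /= !tliftE linearZ.
rewrite [LHS](e (h _)) /=; have := hh ((1 : R) ⊗ m); rewrite [LHS]/= => ->.
by rewrite [LHS]tliftE scale1r.
Qed.

End Projective.

(** * Spans and noetherian rings *)

Section Span.
Variables (A : comPzRingType) (M : lmodType A).

Lemma smD (N : submodule M) x y : N x -> N y -> N (x + y).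
Proof. by move=> Nx Ny; rewrite -[x]scale1r; apply: smP. Qed.

Lemma smZ (N : submodule M) a x : N x -> N (a *: x).
Proof. by move=> Nx; rewrite -[_ *: _]addr0; apply: smP (sm0 N). Qed.

Lemma smB (N : submodule M) x y : N x -> N y -> N (x - y).
Proof. by move=> Nx Ny; rewrite -scaleN1r addrC; apply: smP. Qed.

Lemma sm_sum (N : submodule M) I (r : seq I) (F : I -> M) :
  (forall i, N (F i)) -> N (\sum_(i <- r) F i).
Proof. by move=> NF; apply: big_rec => [|i x _ Nx]; [exact: sm0|exact: smD]. Qed.

Section Gen.
Variable P : M -> Prop.

(** Quantifying over all submodules that contain [P] makes induction on generated elements an
    application to a well-chosen submodule. *)
Definition gen_pred x := forall N : submodule M, (forall y, P y -> N y) -> N x.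

Fact gen0 : gen_pred 0. Proof. by move=> N _; apply: sm0. Qed.

Fact genP a x y : gen_pred x -> gen_pred y -> gen_pred (a *: x + y).
Proof. by move=> gx gy N hN; apply: smP; [apply: gx|apply: gy]. Qed.

Definition gen : submodule M := Submodule gen0 genP.

Lemma mem_gen x : P x -> gen x. Proof. by move=> Px N; apply. Qed.

End Gen.

Definition lspan (s : seq M) : submodule M := gen (fun x => x \in s).

Lemma lspan_sub (s : seq M) (N : submodule M) x :
  (forall y, y \in s -> N y) -> lspan s x -> N x.
Proof. by move=> hN; apply. Qed.

Lemma lspan_subset s t x : {subset s <= t} -> lspan s x -> lspan t x.
Proof. by move=> st; apply: lspan_sub => y /st; apply: mem_gen. Qed.

Fact lspan_nil_closed (a : A) (x y : M) : x = 0 -> y = 0 -> a *: x + y = 0.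
Proof. by move=> -> ->; rewrite scaler0 addr0. Qed.

Lemma lspan_nil x : lspan [::] x -> x = 0.
Proof. by move=> /(_ (Submodule (erefl (0 : M)) lspan_nil_closed)); apply. Qed.

Fact line_plus0 (N : submodule M) y : exists (a : A) z, N z /\ 0 = a *: y + z.
Proof. by exists 0, 0; rewrite scale0r addr0; split=> //; apply: sm0. Qed.

Fact line_plusP (N : submodule M) y (c : A) x x' :
  (exists (a : A) z, N z /\ x = a *: y + z) ->
  (exists (a : A) z, N z /\ x' = a *: y + z) ->
  exists (a : A) z, N z /\ c *: x + x' = a *: y + z.
Proof.
move=> [a [z [Nz ->]]] [a' [z' [Nz' ->]]].
exists (c * a + a'), (c *: z + z'); split; first exact: smP.
by rewrite scalerDr scalerDl -scalerA addrACA.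
Qed.

Lemma lspan_cons y s x : lspan (y :: s) x ->
  exists (a : A) z, lspan s z /\ x = a *: y + z.
Proof.
move=> /(_ (Submodule (line_plus0 (lspan s) y) (@line_plusP (lspan s) y))); apply.
move=> z; rewrite inE => /predU1P[->|zs] /=.
- by exists 1, 0; rewrite scale1r addr0; split=> //; exact: (sm0 (lspan s)).
- by exists 0, z; rewrite scale0r add0r; split=> //;
  exact: (mem_gen (P := fun x => x \in s)).
Qed.

Lemma lspan_sumP s x : lspan s x -> exists c : 'I_(size s) -> A, x = \sum_i c i *: s`_i.
Proof.
elim: s x => [|y s IH] x.
  by move=> /lspan_nil ->; exists (fun=> 0); rewrite big_ord0.
case/lspan_cons=> a [z [/IH[c ->] ->]].
exists (fun i => oapp c a (unlift ord0 i)); rewrite big_ord_recl unlift_none /=.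
by congr (_ + _); apply: eq_bigr => i _; rewrite liftK.
Qed.

Lemma finitely_generatedP : (exists s, forall x, lspan s x) -> finitely_generated M.
Proof. by case=> s hs; exists (size s), (fun i => s`_i) => x; apply/lspan_sumP/hs. Qed.

End Span.

Lemma seq_choice (T U : eqType) (s : seq T) (P : T -> U -> Prop) :
  (forall x, x \in s -> exists y, P x y) ->
  exists t : seq U, (forall y, y \in t -> exists x, x \in s /\ P x y) /\
    (forall x, x \in s -> exists y, y \in t /\ P x y).
Proof.
elim: s => [|x s IH] hs; first by exists [::].
have [y Pxy] := hs x (mem_head _ _).
have [z zs|t [h1 h2]] := IH; first by apply: hs; rewrite inE zs orbT.
exists (y :: t); split=> z; rewrite inE => /predU1P[->|].
- by exists x; rewrite mem_head.
- by case/h1=> w [ws Pw]; exists w; rewrite inE ws orbT.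
- by exists y; rewrite mem_head.
- by case/h2=> w [wt Pw]; exists w; rewrite inE wt orbT.
Qed.

Section Noetherian.
Variable A : comPzRingType.
Hypothesis noethA : noetherian A.

Lemma noetherian_ideal (I : submodule A^o) :
  exists s : seq A^o, (forall x, x \in s -> I x) /\ forall x, I x -> lspan s x.
Proof.
have [x y|r x|n [e [Ie eI]]] := noethA (I := I) (sm0 I); [exact: smD|exact: smZ|].
exists (codom e); split=> [x /codomP[i ->] //|x /eI[c ->]].
apply: (sm_sum (N := lspan (codom e : seq A^o))) => i.
by apply: (smZ (M := A^o)); apply: mem_gen; apply: codom_f.
Qed.

Section LeadingIdeal.
Variables (M : lmodType A) (y : M) (l : seq M) (N : submodule M).

(** The coefficients of [y] that occur in elements of [K], modulo the span of [l]: the analogue of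
    an ideal of leading coefficients. *)
Definition lead_pred (K : M -> Prop) (a : A^o) :=
  exists z, lspan l z /\ K ((a : A) *: y + z).

Fact lead0 (K : submodule M) : lead_pred K 0.
Proof. by exists 0; rewrite addr0 scale0r; split; apply: sm0. Qed.

Fact leadP (K : submodule M) (c : A) (a b : A^o) :
  lead_pred K a -> lead_pred K b -> lead_pred K (c *: a + b).
Proof.
move=> [z [lz Nz]] [z' [lz' Nz']]; exists (c *: z + z'); split; first exact: smP.
have -> : ((c *: a + b : A^o) : A) *: y + (c *: z + z') =
    c *: ((a : A) *: y + z) + ((b : A) *: y + z').
  by rewrite scalerDl -[c *: a]/(c * a) -scalerA scalerDr addrACA.
exact: smP.
Qed.

Definition lead_ideal (K : submodule M) : submodule A^o := Submodule (lead0 K) (@leadP K).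

Fact cap0 : N 0 /\ lspan l 0. Proof. by split; apply: sm0. Qed.
Fact capP (a : A) x x' : N x /\ lspan l x -> N x' /\ lspan l x' ->
  N (a *: x + x') /\ lspan l (a *: x + x').
Proof. by move=> [? ?] [? ?]; split; apply: smP. Qed.
Definition cap_span : submodule M := Submodule cap0 capP.

End LeadingIdeal.

(** Induction on the number of generators of the ambient module. Lifts to [N] of generators of the
    ideal of leading coefficients, together with generators of the intersection of [N] with the span
    of [l], generate [N]. *)
Lemma noetherian_submodule (M : lmodType A) (l : seq M) (N : submodule M) :
  (forall x, N x -> lspan l x) ->
  exists s, (forall x, x \in s -> N x) /\ forall x, N x -> lspan s x.
Proof.
elim: l N => [|y l IH] N hN.
  by exists [::]; split=> // x /hN/lspan_nil ->; apply: sm0.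
have [ideal_gens [Ias ideal_gens_span]] := noetherian_ideal (lead_ideal y l N).
have [|xs [h1 h2]] := @seq_choice _ M ideal_gens
    (fun a x => N x /\ exists z, lspan l z /\ x = (a : A) *: y + z).
  by move=> a /Ias[z [lz Nz]]; exists ((a : A) *: y + z); split=> //; exists z.
have [x [_]|s [sN Ns]] := IH (cap_span l N); first by [].
exists (xs ++ s); split=> [x|x Nx].
  by rewrite mem_cat => /orP[/h1[a [_ []]]//|/sN[]].
have [a [z [lz ex]]] := lspan_cons (hN x Nx).
(* The leading coefficient of [x] is also one of an element of the span of [xs]; the difference of
   the two elements lies in [cap_span l N]. *)
have /ideal_gens_span/(_ (lead_ideal y l (lspan xs))) :
  lead_ideal y l N a by exists z; rewrite -ex.
case=> [b /h2[w [wxs [_ [z' [lz' ew]]]]]|z' [lz' xsw]].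
  by exists z'; split=> //; rewrite -ew; apply: mem_gen.
have xsN w : lspan xs w -> N w.
  by apply: lspan_sub => v /h1[b [_ []]].
rewrite -[x](subrK ((a : A) *: y + z')) addrC; apply: smD.
  by apply: lspan_subset xsw => v vxs; rewrite mem_cat vxs.
apply: (@lspan_subset _ _ s) => [v vs|]; first by rewrite mem_cat vs orbT.
apply: Ns; split; first by apply: smB => //; apply: xsN.
by rewrite ex opprD addrACA subrr add0r; apply: smB.
Qed.

End Noetherian.

(** * Passing from a cover by basic opens to the whole base *)

Section LocalUnity.
Variables (A : comPzRingType) (J : submodule A^o).

Definition rad_pred (a : A) := exists k, J (a ^+ k : A^o).

Lemma radM a b : rad_pred a -> rad_pred (b * a).
Proof. by move=> [k Jk]; exists k; rewrite exprMn_comm;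
  [apply: (smZ (M := A^o))|apply: mulrC]. Qed.

Lemma radD a b : rad_pred a -> rad_pred b -> rad_pred (a + b).
Proof.
move=> [k Jk] [m Jm]; exists (k + m)%N; rewrite exprDn_comm; last exact: mulrC.
apply: (sm_sum (N := J)) => i; rewrite -mulr_natl; apply: (smZ (M := A^o)).
(* A term of the binomial expansion of exponent [k + m] contains either the [m]-th power of [b] or
   the [k]-th power of [a]. *)
have [mi|im] := leqP m i.
  by rewrite -[val i](subnK mi) exprD mulrA; apply: (smZ (M := A^o)).
rewrite mulrC.
have -> : (k + m - i = (m - i) + k)%N by rewrite [RHS]addnC addnBA // ltnW.
by rewrite exprD mulrA; apply: (smZ (M := A^o)).
Qed.

(** The radical of [J] is an ideal containing every [f i], hence 1; and every power of 1 is 1. *)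
Lemma local_unity n (f c : 'I_n -> A) : \sum_i c i * f i = 1 ->
  (forall i, exists k, J (f i ^+ k : A^o)) -> J 1.
Proof.
move=> e hf; suff [k] : rad_pred 1 by rewrite expr1n.
rewrite -e; elim/big_ind: _ => [|a b|i _].
- by exists 1; rewrite expr1; apply: sm0.
- exact: radD.
- exact/radM/hf.
Qed.

End LocalUnity.

(** * Submodules of tensor products and flatness *)

Section LocalFiniteness.
Variables (A : comPzRingType) (H M : lmodType A).

(** The image of [H ⊗ N] in [H ⊗ M]. *)
Definition tens_in (N : submodule M) : submodule (tens H M) :=
  gen (fun t => exists h y, N y /\ t = h ⊗ y).

Lemma tens_in_pure (N : submodule M) h y : N y -> tens_in N (h ⊗ y).
Proof. by move=> Ny; apply: mem_gen; exists h, y. Qed.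

Fact sm_preim0 (P Q : lmodType A) (f : {linear P -> Q}) (K : submodule Q) : K (f 0).
Proof. by rewrite linear0; apply: sm0. Qed.

Fact sm_preimP (P Q : lmodType A) (f : {linear P -> Q}) (K : submodule Q) (a : A) x y :
  K (f x) -> K (f y) -> K (f (a *: x + y)).
Proof. by rewrite linearP; apply: smP. Qed.

Definition sm_preim (P Q : lmodType A) (f : {linear P -> Q}) (K : submodule Q) :
  submodule P := Submodule (sm_preim0 f K) (sm_preimP (f := f) (K := K)).

End LocalFiniteness.

Arguments tens_in {A H M} N.

Section Preimage.
Variable A : comPzRingType.

Lemma tens_in_tevr (H M : lmodType A) (N : submodule M) psi (t : tens H M) :
  tens_in N t -> N (tevr M psi t).
Proof.
move=> /(_ (sm_preim (tevr M psi) N)); apply => _ [h [y [Ny ->]]].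
by change (N (tevr M psi (h ⊗ y))); rewrite tevrE; apply: smZ.
Qed.

Lemma tens_in_tmap (H M : lmodType A) (N : submodule M) (f : {linear H ->
  H}) (t : tens H M) :
  tens_in N t -> tens_in N (tmap f idfun t).
Proof.
move=> /(_ (sm_preim (tmap f idfun) (tens_in N))); apply => _ [h [y [Ny ->]]].
by change (tens_in N (tmap f idfun (h ⊗ y))); rewrite [tmap _ _ _]tliftE;
  apply: tens_in_pure.
Qed.

Fact sm_image0 (P Q : lmodType A) (f : {linear P -> Q}) : exists x, f x = 0.
Proof. by exists 0; rewrite linear0. Qed.

Fact sm_imageP (P Q : lmodType A) (f : {linear P -> Q}) (a : A) x y :
  (exists z, f z = x) -> (exists z, f z = y) -> exists z, f z = a *: x + y.
Proof. by move=> [z <-] [w <-]; exists (a *: z + w); rewrite linearP. Qed.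

Definition sm_image (P Q : lmodType A) (f : {linear P -> Q}) : submodule Q :=
  Submodule (sm_image0 f) (@sm_imageP _ _ f).

Lemma tens_in_lift (H M : lmodType A) (N : submodule M) (t : tens H M) :
  tens_in N t -> exists u, tmap idfun (smincl N) u = t.
Proof.
move=> /(_ (sm_image (tmap idfun (smincl N)))); apply => _ [h [y [Ny ->]]].
by exists (h ⊗ smin Ny); rewrite [LHS]tliftE.
Qed.

(** This is flatness of [H]. Contractions of the factor [H] commute with [i], so those of a tensor
    in the kernel vanish, and by [tens_dual_l] such contractions determine the tensor. *)
Lemma tmap_inj (H M N : lmodType A) (i : {linear M -> N}) :
  locally_dualizable H -> injective i -> injective (tmap (@idfun H) i).
Proof.
move=> dH inj_i t u etu; apply/eqP; rewrite -subr_eq0; apply/eqP.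
have {etu} : tmap (@idfun H) i (t - u) = 0 by rewrite linearB etu subrr.
move: (t - u) => {u}t et.
have ev psi : i (tevr M psi t) = tevr N psi (tmap idfun i t).
  elim/tens_ind: (t) => [|h m|v w ev ew].
  - by rewrite !linear0.
  - by rewrite [tmap _ _ _]tliftE !tevrE linearZ.
  - by rewrite !linearD ev ew.
have [s es] := tens_dual_l t dH.
rewrite es big1 // => y _.
have -> : tevr M y.1 t = 0 by apply: inj_i; rewrite ev et !linear0.
exact: (bilin0r _ (tpure_bilin H M)).
Qed.

End Preimage.

(** * Local finiteness of comodules *)

Section Subcomodule.
Variables (A : comPzRingType) (G : agroup A) (W : gmod G).

Lemma coact_assoc (m : W) : tassoc _ _ _ (tmap (ag_mul G) idfun (gm_coact W m))
  = tmap idfun (gm_coact W) (gm_coact W m).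
Proof. exact: (gm_coactP W).1. Qed.

Lemma coact_counit (m : W) : tunit W (tmap (ag_unit G) idfun (gm_coact W m)) = m.
Proof. exact: (gm_coactP W).2. Qed.

Section Restrict.
Variable N : submodule W.
Hypothesis dG : locally_dualizable G.
Hypothesis stableN : forall m, N m -> tens_in N (gm_coact W m).

Lemma restrict_ex (x : smod N) : exists t : tens G (smod N),
  tmap idfun (smincl N) t = gm_coact W (smincl N x).
Proof. exact/tens_in_lift/stableN/sminclP. Qed.

(** The lift of the coaction is chosen, but it is unique by [incl_inj]; linearity follows from this
    uniqueness. *)
Definition restrict_fun (x : smod N) : tens G (smod N) := sval (cid (restrict_ex x)).

Lemma restrict_funE x :
  tmap idfun (smincl N) (restrict_fun x) = gm_coact W (smincl N x).
Proof. exact: svalP (cid (restrict_ex x)). Qed.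

Lemma incl_inj : injective (tmap (@idfun G) (smincl N)).
Proof. exact/(tmap_inj dG)/smincl_inj. Qed.

Fact restrict_linear : linear restrict_fun.
Proof.
move=> a x y; apply: incl_inj.
by rewrite linearP !restrict_funE !linearP.
Qed.

Definition restrict_coact : {linear smod N -> tens G (smod N)} := mklin restrict_linear.

Lemma restrict_coactE x :
  tmap idfun (smincl N) (restrict_coact x) = gm_coact W (smincl N x).
Proof. exact: restrict_funE. Qed.

Fact restrict_coactP : is_coaction restrict_coact.
Proof.
split=> x; last first.
  apply: (@smincl_inj _ _ N); rewrite -[RHS]coact_counit -restrict_coactE.
  elim/tens_ind: (restrict_coact x) => [|h m|t u et eu]; first by rewrite !linear0.
  - by rewrite !tmapE !tunitE linearZ.
  - by rewrite !linearD et eu.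
(* Flatness used twice: coassociativity may be checked in [G ⊗ (G ⊗ W)], where it is that of [W]. *)
have inj2 := tmap_inj dG incl_inj.
apply: inj2; transitivity (tmap (@idfun G) (gm_coact W) (gm_coact W (smincl N x))).
  rewrite -coact_assoc -restrict_coactE.
  elim/tens_ind: (restrict_coact x) => [|h m|t u et eu]; first by rewrite !linear0.
  - rewrite !tmapE; move: (ag_mul G h : tens G G) => v.
    elim/tens_ind: v => [|a b|v w ev ew].
    + by rewrite !tpure0l !linear0.
    + by rewrite !tassocE !tmapE.
    + by rewrite !tpureDl !linearD ev ew.
  - by rewrite !linearD et eu.
rewrite -restrict_coactE.
elim/tens_ind: (restrict_coact x) => [|h m|t u et eu]; first by rewrite !linear0.
- by rewrite !tmapE restrict_coactE.
- by rewrite !linearD et eu.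
Qed.

Definition restrict : gmod G := GMod restrict_coactP.

Lemma restrict_equivariant : @equivariant _ _ restrict W (smincl N).
Proof. by move=> x; rewrite -restrict_coactE. Qed.

End Restrict.

Section Finite.
Hypothesis noethA : noetherian A.
Hypothesis dG : locally_dualizable G.
Variable l : seq W.

Definition coact_coefs : seq W :=
  flatten [seq [seq y.2 | y <- trep (gm_coact W x)] | x <- l].

(* Since the coaction is coassociative, the elements whose coaction has its
   coefficients in a fixed submodule form a subcomodule. *)
Definition coef_sub : submodule W := sm_preim (gm_coact W) (tens_in (lspan coact_coefs)).

Lemma coef_sub_list x : x \in l -> coef_sub x.
Proof.
move=> xl; change (tens_in (lspan coact_coefs) (gm_coact W x)).
rewrite -[gm_coact W x]trepK tcls_sum big_seq.
apply: big_ind => [|u v|y yt]; [exact: sm0|exact: smD|].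
apply/tens_in_pure/mem_gen/flattenP.
by exists [seq y.2 | y <- trep (gm_coact W x)]; apply: map_f.
Qed.

Lemma tevr_counit x : tevr W (ag_unit G : {linear G -> A^o}) (gm_coact W x) = x.
Proof. exact: coact_counit. Qed.

Lemma coef_sub_span x : coef_sub x -> lspan coact_coefs x.
Proof. by move=> cx; rewrite -(tevr_counit x); apply: tens_in_tevr. Qed.

(** Coassociativity: applying the coaction to a contraction of [mu x] amounts to changing only the
    [G]-factor of [mu x], so no new coefficients in [W] appear. *)
Lemma coact_tevr (psi : {linear G -> A^o}) x :
  gm_coact W (tevr W psi (gm_coact W x)) =
  tmap (tevr G psi \o ag_mul G) idfun (gm_coact W x).
Proof.
have e1 t : gm_coact W (tevr W psi t) = tevr (tens G W) psi (tmap idfun (gm_coact W) t).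
  elim/tens_ind: t => [|h m|t u et eu]; first by rewrite !linear0.
  - by rewrite tmapE !tevrE linearZ.
  - by rewrite !linearD et eu.
rewrite e1 -coact_assoc; move: (gm_coact W x) => {x}t.
elim/tens_ind: t => [|h m|t u et eu]; first by rewrite !linear0.
- rewrite !tmapE -[X in _ = X ⊗ _]/(tevr G psi (ag_mul G h));
  move: (ag_mul G h : tens G G) => v.
  elim/tens_ind: v => [|a b|v w ev ew].
  + by rewrite [tevr G psi 0]linear0 !tpure0l !linear0.
  + by rewrite tassocE !tevrE tpureZl.
  + by rewrite (linearD (tevr G psi)) !tpureDl !linearD ev ew.
- by rewrite !linearD et eu.
Qed.

(** A local dual system of [G] writes [mu x] with contractions of [mu x] as coefficients, and
    [coact_tevr] puts these in [coef_sub]. *)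
Lemma coef_sub_stable x : coef_sub x -> tens_in coef_sub (gm_coact W x).
Proof.
move=> cx; have [s ->] := tens_dual_l (gm_coact W x) dG.
apply: sm_sum => y; apply: tens_in_pure.
change (tens_in (lspan coact_coefs) (gm_coact W (tevr W y.1 (gm_coact W x)))).
by rewrite coact_tevr; apply: tens_in_tmap.
Qed.

(** The subcomodule [coef_sub] lies in the span of finitely many elements by the counit axiom, so it
    is finitely generated over the noetherian ring [A]. *)
Lemma finite_subcomodule : exists (M : gmod G) (p : {linear M -> W}),
  [/\ finitely_generated M, equivariant p & forall x, x \in l -> exists m, p m = x].
Proof.
exists (restrict dG coef_sub_stable), (smincl coef_sub); split.
- have [s [sN Ns]] := noetherian_submodule noethA coef_sub_span.
  apply: finitely_generatedP.
  have [y ys|t [h1 h2]] := @seq_choice _ (smod coef_sub) s (fun y m => smincl coef_sub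
    m = y).
    by exists (smin (sN y ys)).
  exists t => m; have := Ns _ (sminclP m).
  suff h y : lspan s y -> exists2 m', smincl coef_sub m' = y & lspan t m'.
    by move/h=> [m' /smincl_inj ->].
  have i0 : exists2 m', smincl coef_sub m' = 0 & lspan t m'.
    by exists 0; [rewrite linear0|apply: sm0].
  have iP (a : A) x z : (exists2 m', smincl coef_sub m' = x & lspan t m') ->
      (exists2 m', smincl coef_sub m' = z & lspan t m') ->
      exists2 m', smincl coef_sub m' = a *: x + z & lspan t m'.
    move=> [u <- tu] [v <- tv]; exists (a *: u + v); first by rewrite linearP.
    exact: smP.
  move=> /(_ (Submodule i0 iP)); apply => z /h2[w [wt ew]].
  by exists w => //; apply: mem_gen.
- exact: restrict_equivariant.
- by move=> x /coef_sub_list cx; exists (smin cx).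
Qed.

Lemma resolution_cover : resolution_property G ->
  exists (E : gmod G) (p : {linear E -> W}),
  [/\ locally_free_of_finite_rank E, equivariant p & forall x, x \in l ->
    exists e, p e = x].
Proof.
move=> resG; have [M [q [fgM eq_q q_l]]] := finite_subcomodule.
have [E [p [lfE eq_p ps]]] := resG M fgM.
exists E, (q \o p); split=> // [e|x /q_l[m <-]].
  rewrite [LHS]/= eq_q eq_p.
  elim/tens_ind: (gm_coact E e) => [|h m|t u et eu]; first by rewrite !linear0.
  - by rewrite !tmapE.
  - by rewrite !linearD et eu.
by have [e <-] := ps m; exists e.
Qed.

End Finite.
End Subcomodule.

(** * Comatrices and the antipode *)

Section Scalars.
Variable A : comPzRingType.

Definition scal_fun (B : calg A) (a : A) : B := a *: (1 : B).

Fact scal_zmod (B : calg A) : zmod_morphism (@scal_fun B).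
Proof. by move=> a b; apply: scalerBl. Qed.

Fact scal_monoid (B : calg A) : monoid_morphism (@scal_fun B).
Proof.
split=> [|a b]; first exact: scale1r.
by rewrite /scal_fun cscalerAl mul1r scalerA.
Qed.

Definition scal (B : calg A) : {rmorphism A -> B} :=
  HB.pack (@scal_fun B) (GRing.isZmodMorphism.Build A B _ (@scal_zmod B))
    (GRing.isMonoidMorphism.Build A B _ (@scal_monoid B)).

Lemma scalE (B : calg A) a (x : B) : scal B a * x = a *: x.
Proof. by rewrite [LHS]cscalerAl mul1r. Qed.

Lemma ahom_scal (B C : calg A) (f : ahom B C) a : f (scal B a) = scal C a.
Proof. exact: etrans (linearZZ (ahom_lin f) a 1) (congr1 _ (ahom1 f)). Qed.

Lemma map_ahom_scal (B C : calg A) (f : ahom B C) m n (X : 'M[A]_(m, n)) :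
  map_mx f (map_mx (scal B) X) = map_mx (scal C) X.
Proof. by apply/matrixP => i j; rewrite !mxE ahom_scal. Qed.

Lemma map_ahomM (B C : calg A) (f : ahom B C) m n p (X : 'M[B]_(m, n)) (Y :
  'M[B]_(n, p)) :
  map_mx f (X *m Y) = map_mx f X *m map_mx f Y.
Proof. exact: (map_mxM (amorph f)). Qed.

Section Inclusions.
Variables B C : calg A.

Fact tens_inl_linear : linear (fun b : B => b ⊗ (1 : C) : tens_alg B C).
Proof. exact: (tpure_bilin B C).1. Qed.

Fact tens_inl_mul : monoid_morphism (mklin tens_inl_linear).
Proof. by split=> // x y; rewrite [RHS]tmulE mulr1. Qed.

Definition tens_inl : ahom B (tens_alg B C) := AHom tens_inl_mul.

Fact tens_inr_linear : linear (fun c : C => (1 : B) ⊗ c : tens_alg B C).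
Proof. exact: (tpure_bilin B C).2. Qed.

Fact tens_inr_mul : monoid_morphism (mklin tens_inr_linear).
Proof. by split=> // x y; rewrite [RHS]tmulE mulr1. Qed.

Definition tens_inr : ahom C (tens_alg B C) := AHom tens_inr_mul.

Lemma tens_inlr b c : tens_inl b * tens_inr c = b ⊗ c.
Proof. by rewrite [LHS]tmulE mulr1 mul1r. Qed.

Lemma apairE (D : calg A) (f : ahom B D) (g : ahom C D) b c :
  apair f g (b ⊗ c) = f b * g c.
Proof. exact: apair_linE. Qed.

Lemma apair_inl (D : calg A) (f : ahom B D) (g : ahom C D) b :
  apair f g (tens_inl b) = f b.
Proof. by rewrite [LHS]apairE (ahom1 g) mulr1. Qed.

Lemma apair_inr (D : calg A) (f : ahom B D) (g : ahom C D) c :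
  apair f g (tens_inr c) = g c.
Proof. by rewrite [LHS]apairE (ahom1 f) mul1r. Qed.

Lemma map_apair (D : calg A) (f : ahom B D) (g : ahom C D) m n p
  (X : 'M[B]_(m, n)) (Y : 'M[C]_(n, p)) :
  map_mx (apair f g) (map_mx tens_inl X *m map_mx tens_inr Y) = map_mx f X *m map_mx g Y.
Proof.
rewrite map_ahomM; congr (_ *m _); apply/matrixP => i j; rewrite !mxE.
- exact: apair_inl.
- exact: apair_inr.
Qed.

End Inclusions.
End Scalars.

Section Comatrix.
Variables (A : comPzRingType) (G : agroup A).

Fact counit_zmod : zmod_morphism (ag_unit G : G -> A).
Proof. exact: (raddfB (ag_unit G)). Qed.

Fact counit_monoid : monoid_morphism (ag_unit G : G -> A).
Proof. exact: (ahom_mul (ag_unit G)). Qed.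

Definition counit : {rmorphism G -> A} :=
  HB.pack (ag_unit G : G -> A) (GRing.isZmodMorphism.Build G A _ counit_zmod)
    (GRing.isMonoidMorphism.Build G A _ counit_monoid).

Lemma counit_scal a : counit (scal G a) = a.
Proof. by rewrite /= /scal_fun linearZ (ahom1 (ag_unit G)); apply: mulr1. Qed.

Lemma map_counit_scal m n (X : 'M[A]_(m, n)) : map_mx counit (map_mx (scal G) X) = X.
Proof. by apply/matrixP => i j; rewrite !mxE counit_scal. Qed.

(** Stated as a product of matrices over [G ⊗ G], so that the Hopf algebra identities become matrix
    identities. The counit of [C] need not be the identity matrix: it is an idempotent, since [C]
    may come from generators that are not a basis. *)
Definition comatrix n (C : 'M[G]_n) :=
  map_mx (ag_mul G) C = map_mx (tens_inl G G) C *m map_mx (tens_inr G G) C.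

Lemma comatrix_coef n (C : 'M[G]_n) : comatrix C ->
  forall i j, ag_mul G (C i j) = \sum_k C i k ⊗ C k j.
Proof.
move=> /matrixP hC i j; have := hC i j; rewrite !mxE => ->.
by apply: eq_bigr => k _; rewrite !mxE tens_inlr.
Qed.

(** Uniqueness of inverses relative to [E]: [Z = E Z = S2 S1 C1 C2 Z = S2 S1 E = S2 S1]. *)
Fact antipode_mul_eq (R : comPzRingType) n (E Z C1 C2 S1 S2 : 'M[R]_n) :
  E *m Z = Z -> C1 *m C2 *m Z = E -> S1 *m E = S1 -> S2 *m E = S2 ->
  S1 *m C1 = E -> S2 *m C2 = E -> Z = S2 *m S1.
Proof.
move=> EZ CZ S1E S2E SC1 SC2.
have h : S2 *m S1 *m (C1 *m C2) = E by rewrite mulmxA -(mulmxA S2) SC1 S2E.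
by rewrite -EZ -h -mulmxA CZ -mulmxA S1E.
Qed.

Section OneComatrix.
Variables (n : nat) (C : 'M[G]_n).
Hypothesis hC : comatrix C.
Local Notation sc := (map_mx (scal G)).
Local Notation e := (map_mx counit C).
Local Notation SC := (map_mx (ag_inv G) C).

Lemma comatrix_apair (D : calg A) (f g : ahom G D) :
  map_mx (apair f g) (map_mx (ag_mul G) C) = map_mx f C *m map_mx g C.
Proof. by rewrite hC map_apair. Qed.

Lemma comatrix_counitl : sc e *m C = C.
Proof.
pose f := ahom_comp (ahom_str G) (ag_unit G).
have e1 : map_mx (apair f (ahom_id G)) (map_mx (ag_mul G) C) = C.
  by apply/matrixP => i j; rewrite !mxE; apply: ag_mul1l.
rewrite -[RHS]e1 comatrix_apair; congr (_ *m _); apply/matrixP => i j; by rewrite !mxE.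
Qed.

Lemma comatrix_counitr : C *m sc e = C.
Proof.
pose f := ahom_comp (ahom_str G) (ag_unit G).
have e1 : map_mx (apair (ahom_id G) f) (map_mx (ag_mul G) C) = C.
  by apply/matrixP => i j; rewrite !mxE; apply: ag_mul1r.
rewrite -[RHS]e1 comatrix_apair; congr (_ *m _); apply/matrixP => i j; by rewrite !mxE.
Qed.

Lemma counit_idem : e *m e = e.
Proof. by rewrite -{1}(map_counit_scal e) -map_mxM comatrix_counitl. Qed.

Lemma comatrix_invl : SC *m C = sc e.
Proof.
have <- : map_mx (apair (ag_inv G) (ahom_id G)) (map_mx (ag_mul G) C) = sc e.
  by apply/matrixP => i j; rewrite !mxE; apply: ag_mulVl.
by rewrite comatrix_apair; congr (_ *m _); apply/matrixP => i j; rewrite !mxE.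
Qed.

Lemma comatrix_invr : C *m SC = sc e.
Proof.
have <- : map_mx (apair (ahom_id G) (ag_inv G)) (map_mx (ag_mul G) C) = sc e.
  by apply/matrixP => i j; rewrite !mxE; apply: ag_mulVr.
by rewrite comatrix_apair; congr (_ *m _); apply/matrixP => i j; rewrite !mxE.
Qed.

Lemma antipode_counitl : sc e *m SC = SC.
Proof. by rewrite -(map_ahom_scal (ag_inv G)) -map_ahomM comatrix_counitl. Qed.

Lemma antipode_counitr : SC *m sc e = SC.
Proof. by rewrite -(map_ahom_scal (ag_inv G)) -map_ahomM comatrix_counitr. Qed.

(** Both sides are inverse to [SC] relative to the idempotent [e]. *)
Lemma antipodeK : map_mx (ag_inv G) SC = C.
Proof.
have h : map_mx (ag_inv G) SC *m sc e = map_mx (ag_inv G) SC.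
  by rewrite -(map_ahom_scal (ag_inv G)) -map_ahomM antipode_counitr.
rewrite -h -comatrix_invl mulmxA -map_ahomM comatrix_invl map_ahom_scal.
exact: comatrix_counitl.
Qed.

Lemma map_antipode_mul (f : ahom G (tens_alg G G)) :
  map_mx f SC *m map_mx f C = map_mx (scal _) e.
Proof. by rewrite -map_ahomM comatrix_invl map_ahom_scal. Qed.

(* Both sides are two-sided inverses, up to the idempotent [e], of the
   comultiplication of [C]. *)
Lemma antipode_mul : map_mx (ag_mul G) SC =
  map_mx (tens_inr G G) SC *m map_mx (tens_inl G G) SC.
Proof.
set Z := map_mx _ SC; have hZ : map_mx (scal _) e *m Z = Z.
  by rewrite -(map_ahom_scal (ag_mul G)) -map_ahomM antipode_counitl.
have CZ : map_mx (ag_mul G) C *m Z = map_mx (scal _) e.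
  by rewrite -map_ahomM comatrix_invr map_ahom_scal.
have S1 : map_mx (tens_inl G G) SC *m map_mx (scal _) e = map_mx (tens_inl G G) SC.
  by rewrite -(map_ahom_scal (tens_inl G G)) -map_ahomM antipode_counitr.
have S2 : map_mx (tens_inr G G) SC *m map_mx (scal _) e = map_mx (tens_inr G G) SC.
  by rewrite -(map_ahom_scal (tens_inr G G)) -map_ahomM antipode_counitr.
apply: antipode_mul_eq hZ _ S1 S2 (map_antipode_mul _) (map_antipode_mul _).
by rewrite -hC.
Qed.

(** The antipode reverses the order of the product, and transposition restores it; this is the
    comatrix of the dual comodule. *)
Lemma comatrix_dual : comatrix (SC^T).
Proof. by rewrite /comatrix -!map_trmx antipode_mul trmx_mul. Qed.

(** The counit of [SC] is unchanged by multiplication by [e], the counit of [C], so it is the counit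
    of [SC *m C], that is [e]. *)
Lemma counit_dual : map_mx counit (SC^T) = e^T.
Proof.
rewrite -map_trmx; congr (_^T); transitivity (map_mx counit SC *m e).
  by rewrite -{1}antipode_counitr map_mxM map_counit_scal.
by rewrite -map_mxM comatrix_invl map_counit_scal.
Qed.

End OneComatrix.
End Comatrix.

(** * The invariant retraction *)

Section Reductive.
Variables (A : comPzRingType) (G : agroup A).
Variable r : {linear reg_gmod G -> triv_gmod G A^o}.
Hypothesis r_eq : equivariant r.
Hypothesis r_str : forall a : A, r (ahom_str G a) = a.

Definition ret (h : G) : A := r h.

Lemma retZ a h : ret (a *: h) = a * ret h.
Proof. exact: (linearZZ r). Qed.

Lemma ret_sum I (s : seq I) (F : I ->
  G) : ret (\sum_(i <- s) F i) = \sum_(i <- s) ret (F i).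
Proof. exact: (linear_sum r). Qed.

Lemma ret_scal a : ret (scal G a) = a.
Proof. exact: r_str. Qed.

Lemma retB x y : ret (x - y) = ret x - ret y.
Proof. exact: (linearB r). Qed.

Definition tens_ret : {linear tens G G -> G} := tevl G (r : {linear G -> A^o}).

Lemma tens_retE x y : tens_ret (x ⊗ y) = ret y *: x.
Proof. exact: tevlE. Qed.

(** Equivariance of [r] for the trivial coaction on [A] says that [r] is an invariant integral on
    the Hopf algebra. *)
Lemma tens_ret_mul h : tens_ret (ag_mul G h) = scal G (ret h).
Proof.
have -> : scal G (ret h) = tevl G (idfun : {linear A^o ->
  A^o}) (gm_coact (triv_gmod G A^o) (r h)).
  by rewrite [RHS]tevlE.
have -> : gm_coact (triv_gmod G A^o) (r h) = tmap idfun (r : {linear G ->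
  A^o}) (ag_mul G h : tens G G).
  exact: (r_eq h).
elim/tens_ind: (ag_mul G h : tens G G) => [|x y|t u et eu]; first by rewrite !linear0.
- by rewrite tmapE tens_retE tevlE.
- by rewrite !linearD et eu.
Qed.

Lemma map_ret_mulr m n p (X : 'M[G]_(m, n)) (Y : 'M[A]_(n, p)) :
  map_mx ret (X *m map_mx (scal G) Y) = map_mx ret X *m Y.
Proof.
apply/matrixP => i j; rewrite !mxE ret_sum; apply: eq_bigr => k _.
by rewrite !mxE mulrC scalE retZ mulrC.
Qed.

Lemma map_ret_mull m n p (X : 'M[A]_(m, n)) (Y : 'M[G]_(n, p)) :
  map_mx ret (map_mx (scal G) X *m Y) = X *m map_mx ret Y.
Proof.
apply/matrixP => i j; rewrite !mxE ret_sum; apply: eq_bigr => k _.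
by rewrite !mxE scalE retZ.
Qed.

Lemma map_ret_scal m n (X : 'M[A]_(m, n)) : map_mx ret (map_mx (scal G) X) = X.
Proof. by apply/matrixP => i j; rewrite !mxE ret_scal. Qed.

Section OneComatrix.
Variables (n : nat) (C : 'M[G]_n).
Hypothesis hC : comatrix C.
Local Notation sc := (map_mx (scal G)).
Local Notation e := (map_mx (counit G) C).
Local Notation SC := (map_mx (ag_inv G) C).
Local Notation R := (map_mx ret C).

(** Apply the invariance of the integral to each comultiplication
    [Delta(D_ij) = sum_k D_ik ⊗ D_kj]. *)
Lemma comatrix_mul_ret D : comatrix D ->
  D *m sc (map_mx ret D) = sc (map_mx ret D) :> 'M[G]_n.
Proof.
move=> hD; apply/matrixP => i j; rewrite !mxE -tens_ret_mul (comatrix_coef hD) linear_sum.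
by apply: eq_bigr => k _; rewrite tens_retE !mxE mulrC scalE.
Qed.

Local Notation R' := (map_mx ret SC).

(** Invariance for the dual comatrix, transposed, gives [R' SC = R']; multiplying by [C] on the
    right turns this into invariance on the other side. *)
Fact ret_antipode_mul : sc R' *m C = sc R'.
Proof.
have h : sc R' *m SC = sc R'.
  have := comatrix_mul_ret (comatrix_dual hC); rewrite -!map_trmx => h.
  by apply: trmx_inj; rewrite trmx_mul.
have he : sc R' *m sc e = sc R'.
  by rewrite -[in LHS]h -mulmxA antipode_counitr.
by rewrite -[in LHS]h -mulmxA comatrix_invl.
Qed.

(* Uniqueness of the retraction: a left-invariant and a right-invariant one
   agree. *)
Lemma ret_antipode : R' = R.
Proof.
(* The product [R' R] is computed twice: as [r] of [R' C = R'] here, and as [r] of [SC R = R]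
   below. *)
have <- : R' *m R = R'.
  by rewrite -map_ret_mull ret_antipode_mul map_ret_scal.
have h : SC *m sc R = sc R.
  have hC' := comatrix_mul_ret hC.
  rewrite -[in LHS]hC' mulmxA comatrix_invl // -[in LHS]hC' mulmxA.
  by rewrite comatrix_counitl.
by rewrite -map_ret_mulr h map_ret_scal.
Qed.

Lemma ret_mul_comatrix : sc R *m C = sc R.
Proof. by rewrite -ret_antipode ret_antipode_mul. Qed.

Lemma ret_idem : R *m R = R.
Proof. by rewrite -map_ret_mull ret_mul_comatrix map_ret_scal. Qed.

Definition nonfixed : 'M[G]_n := C - sc R.

(** In the expansion of [(C - R) ⊗ (C - R)] the terms [C R], [R C] and [R R] all equal [R], which
    leaves the comultiplication of [C] minus [R]. *)
Lemma comatrix_nonfixed : comatrix nonfixed.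
Proof.
have mB (B : calg A) (f : ahom G B) : map_mx f nonfixed = map_mx f C - map_mx (scal B) R.
  by rewrite -(map_ahom_scal f); apply: (map_mxB (amorph f)).
rewrite /comatrix !mB hC mulmxBl !mulmxBr.
have -> : map_mx (tens_inl G G) C *m map_mx (scal _) R = map_mx (scal _) R.
  by rewrite -(map_ahom_scal (tens_inl G G)) -map_ahomM comatrix_mul_ret.
have -> : map_mx (scal _) R *m map_mx (tens_inr G G) C = map_mx (scal _) R.
  by rewrite -(map_ahom_scal (tens_inr G G)) -map_ahomM ret_mul_comatrix.
by rewrite -map_mxM ret_idem subrr subr0.
Qed.

Lemma ret_nonfixed : map_mx ret nonfixed = 0.
Proof. by apply/matrixP => i j; rewrite !mxE retB ret_scal subrr. Qed.

End OneComatrix.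

Lemma ret_dual n (C : 'M[G]_n) : comatrix C -> map_mx ret C = 0 ->
  map_mx ret (map_mx (ag_inv G) C)^T = 0.
Proof. by move=> hC C0; rewrite -map_trmx ret_antipode // C0 trmx0. Qed.

End Reductive.

(** * The comodule of a comatrix *)

Section IdempotentModule.
Variables (A : comPzRingType) (n : nat) (e : 'M[A]_n).
Hypothesis e_idem : e *m e = e.

(** For an idempotent [e] these rows form the image of right multiplication by [e]. *)
Definition fixed_row_pred (v : 'rV[A]_n) := v *m e = v.

Fact fixed_row0 : fixed_row_pred 0. Proof. exact: mul0mx. Qed.

Fact fixed_rowP (a : A) v w : fixed_row_pred v -> fixed_row_pred w ->
  fixed_row_pred (a *: v + w).
Proof. by rewrite /fixed_row_pred mulmxDl -scalemxAl => -> ->. Qed.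

Definition row_image : submodule 'rV[A]_n := Submodule fixed_row0 fixed_rowP.

Local Notation V := (smod row_image).

Fact row_e_fixed i : row_image (row i e).
Proof. by rewrite /= /fixed_row_pred -row_mul e_idem. Qed.

Definition gen_row i : V := smin (row_e_fixed i).

Fact entry_linear j : linear (fun v : V => (smincl row_image v) 0 j : A^o).
Proof. by move=> a v w; rewrite linearP !mxE. Qed.

Definition entry j : {linear V -> A^o} := mklin (entry_linear j).

Lemma entry_gen_row i j : entry j (gen_row i) = e i j.
Proof. by rewrite [LHS]mxE. Qed.

Definition row_dual := [seq (entry j, gen_row j) | j <- enum 'I_n].

(** The identity [v = v e], read row by row: the rows of [e] generate the image, with the entries of
    [v] as coefficients. *)
Lemma row_dual_sum v : dual_sum row_dual v = v.
Proof.
rewrite /dual_sum big_map big_enum; apply: smincl_inj.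
rewrite linear_sum -[RHS](sminclP v : _ *m _ = _) [RHS]mulmx_sum_row.
by apply: eq_bigr => j _; apply: (linearZZ (smincl row_image)).
Qed.

Lemma tens_gen_row (M : lmodType A) (t : tens M V) :
  t = \sum_j tevl M (entry j) t ⊗ gen_row j.
Proof. by rewrite {1}(tens_dual_r t row_dual_sum) big_map big_enum. Qed.

Lemma tens_entry_inj (M : lmodType A) (t u : tens M V) :
  (forall j, tevl M (entry j) t = tevl M (entry j) u) -> t = u.
Proof.
move=> h; rewrite [t]tens_gen_row [u]tens_gen_row.
by apply: eq_bigr => j _; rewrite h.
Qed.

Lemma tens_entry_sum (M : lmodType A) (w : 'I_n -> M) j :
  tevl M (entry j) (\sum_i w i ⊗ gen_row i) = \sum_i e i j *: w i.
Proof. by rewrite linear_sum; apply: eq_bigr => i _; rewrite tevlE entry_gen_row. Qed.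

End IdempotentModule.

Section ComatrixModule.
Variables (A : comPzRingType) (G : agroup A) (n : nat) (D : 'M[G]_n).
Hypothesis hD : comatrix D.
Local Notation e := (map_mx (counit G) D).
Local Notation V := (smod (row_image e)).

Definition coef (v : 'rV[A]_n) j : G := \sum_i v 0 i *: D i j.

Lemma coefE v j : (map_mx (scal G) v *m D) 0 j = coef v j.
Proof. by rewrite mxE; apply: eq_bigr => i _; rewrite mxE scalE. Qed.

Lemma coef_row_counit k j : coef (row k e) j = D k j.
Proof. by rewrite -coefE map_row -row_mul comatrix_counitl // mxE. Qed.

Lemma coef_linear j : linear (coef^~ j : 'rV[A]_n -> G).
Proof.
move=> a v w; rewrite /coef scaler_sumr -big_split; apply: eq_bigr => i _ /=.
by rewrite !mxE scalerDl scalerA.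
Qed.

Lemma coef_mul v j : ag_mul G (coef v j) = \sum_k coef v k ⊗ D k j.
Proof.
rewrite /coef linear_sum; under [RHS]eq_bigr do rewrite tpure_suml.
rewrite exchange_big; apply: eq_bigr => i _.
rewrite (linearZZ (ag_mul G)) comatrix_coef // scaler_sumr.
by apply: eq_bigr => k _; rewrite tpureZl.
Qed.

Lemma counit_coef v j : counit G (coef v j) = (v *m e) 0 j.
Proof.
by rewrite -coefE -[v in RHS](map_counit_scal G) -map_mxM [RHS]mxE.
Qed.

Definition cmod_fun (v : V) : tens G V :=
  \sum_j coef (smincl _ v) j ⊗ gen_row (counit_idem hD) j.

Fact cmod_linear : linear cmod_fun.
Proof.
move=> a v w; rewrite /cmod_fun (linearP (smincl (row_image e))) scaler_sumr -big_split.
by apply: eq_bigr => j _; rewrite coef_linear tpureDl tpureZl.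
Qed.

Definition cmod_coact : {linear V -> tens G V} := mklin cmod_linear.

Lemma cmod_coactE v :
  cmod_coact v = \sum_j coef (smincl _ v) j ⊗ gen_row (counit_idem hD) j.
Proof. by []. Qed.

Lemma cmod_gen_row k :
  cmod_coact (gen_row (counit_idem hD) k) = \sum_j D k j ⊗ gen_row (counit_idem hD) j.
Proof. by apply: eq_bigr => j _; rewrite -coef_row_counit. Qed.

(** Coassociativity is the comatrix identity applied to the row [v D]; the counit axiom is
    [v e = v], which holds because [v] lies in the image of [e]. *)
Fact cmod_coactP : is_coaction cmod_coact.
Proof.
split=> v; rewrite cmod_coactE.
  rewrite !(linear_sum (tmap _ _)) (linear_sum (tassoc _ _ _)).
  under [RHS]eq_bigr do rewrite tmapE cmod_gen_row tpure_sumr.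
  rewrite exchange_big; apply: eq_bigr => j _.
  rewrite tmapE coef_mul tpure_suml (linear_sum (tassoc _ _ _)); apply: eq_bigr => k _.
  by rewrite tassocE.
rewrite (linear_sum (tmap _ _)) (linear_sum (tunit _)) -[RHS](row_dual_sum (counit_idem
  hD)) /dual_sum big_map big_enum.
apply: eq_bigr => j _; rewrite tmapE tunitE; congr (_ *: _).
by rewrite [LHS]counit_coef (sminclP v : _ *m _ = _).
Qed.

Definition cmod : gmod G := GMod cmod_coactP.

(** Contracting [1 ⊗ v = mu v] with the entries gives [v e = v D e] over [G], and [D e = D]. *)
Lemma cmod_fixed (v : cmod) : gm_fixed v ->
  map_mx (scal G) (smincl (row_image e) v) *m D = map_mx (scal G) (smincl _ v).
Proof.
move=> /subr0_eq fv; set w := smincl _ v; set X := _ *m D.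
have hX : X = X *m map_mx (scal G) e by rewrite -mulmxA comatrix_counitr.
rewrite hX; apply/rowP => j; rewrite mxE [RHS]mxE.
have := congr1 (tevl G (entry e j)) fv; rewrite tevlE.
rewrite [gm_coact _ _]/(cmod_fun v) /cmod_fun tens_entry_sum => h.
transitivity (tevl G (entry e j) (cmod_fun v)).
  rewrite tens_entry_sum; apply: eq_bigr => i _.
  by rewrite coefE mxE mulrC scalE.
by rewrite tens_entry_sum -h.
Qed.

End ComatrixModule.

(** * Equivariant sections and fixed points *)

Section LinearSection.
Variables (A : comPzRingType) (G : agroup A) (X : gscheme G) (n : nat).
Variables (C : 'M[G]_n) (b : 'I_n -> X).
Hypothesis hC : comatrix C.
Hypothesis hb : forall i, gs_act X (b i) = \sum_j C i j ⊗ b j.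
Local Notation D := (map_mx (ag_inv G) C)^T.
Local Notation hD := (comatrix_dual hC).
Local Notation eD := (counit_idem hD).
Local Notation V := (cmod hD).

(** The canonical tensor pairing the [b i] with the generators of the comodule dual to that of
    [C]. *)
Definition lin_section : bchange X V := \sum_i b i ⊗ gen_row eD i.

Lemma act_pt_coord (R : calg A) (g : ahom G R) (x : ahom X R) i :
  act_pt g x (b i) = \sum_j g (C i j) * x (b j).
Proof.
transitivity (apair g x (\sum_j C i j ⊗ b j)); first exact: (congr1 (apair g x) (hb i)).
rewrite (linear_sum (apair g x)).
by apply: eq_bigr => j _; rewrite apairE.
Qed.

Lemma gm_actE (R : calg A) (g : ahom G R) (a : R) v :
  gm_act g (a ⊗ v : bchange R V) =
  bscale a (tmap (ahom_comp g (ag_inv G)) idfun (gm_coact V v)).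
Proof. exact: (tliftE (gm_ract_bilin V (ahom_comp g (ag_inv G)))). Qed.

Lemma bscale_sum (R : calg A) (M : lmodType A) (a : R) I (s : seq I) (F : I ->
  bchange R M) :
  bscale a (\sum_(i <- s) F i) = \sum_(i <- s) bscale a (F i).
Proof.
elim: s => [|i s IH]; first by rewrite !big_nil bscale0r.
by rewrite !big_cons bscaleDr IH.
Qed.

Lemma gm_act_sum (R : calg A) (g : ahom G R) I (s : seq I) (F : I -> bchange R V) :
  gm_act g (\sum_(i <- s) F i) = \sum_(i <- s) gm_act g (F i).
Proof. exact: (linear_sum (tlift (gm_ract_bilin V (ahom_comp g (ag_inv G))))). Qed.

(** The matrix of the dual comodule is the transpose of the antipode of [C], and [gm_act] applies
    the antipode once more. Both sides become the sum of the
    [g (C i j) * x (b j) ⊗ gen_row eD i]. *)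
Lemma lin_section_equivariant : equivariant_section lin_section.
Proof.
move=> R g x.
have -> : bmap (act_pt g x) lin_section = \sum_i act_pt g x (b i) ⊗ gen_row eD i.
  by rewrite [LHS](linear_sum (tmap _ _)); apply: eq_bigr => i _; rewrite tmapE.
have -> : bmap x lin_section = \sum_i (x (b i) ⊗ gen_row eD i : bchange R V).
  by rewrite [LHS](linear_sum (tmap _ _)); apply: eq_bigr => i _; rewrite tmapE.
rewrite gm_act_sum; under [RHS]eq_bigr => i _.
  rewrite gm_actE [gm_coact V _]cmod_gen_row (linear_sum (tmap _ _)) bscale_sum.
  under eq_bigr => j _.
    rewrite tmapE bscaleE.
    (* The two antipodes cancel on the coefficients of a comatrix. *)
    have -> : ahom_comp g (ag_inv G) (D i j) = g (C j i).
      by rewrite -[in RHS](antipodeK hC) !mxE.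
    over.
  over.
rewrite exchange_big; apply: eq_bigr => j _.
rewrite act_pt_coord tpure_suml; apply: eq_bigr => i _; by rewrite [g _ * _]mulrC.
Qed.

Fact bentry_linear j : linear (tevl X (entry (map_mx (counit G) D) j) :
  bchange X V -> (X : comPzRingType)^o).
Proof.
move=> a t u; rewrite [LHS]linearD; congr (_ + _).
change (tevl X (entry (map_mx (counit G) D) j) (bscale a t) =
  a * tevl X (entry (map_mx (counit G) D) j) t).
elim/bchange_ind: t => [|h v|t w et ew].
- by rewrite bscale0r linear0 mulr0.
- by rewrite bscaleE !tevlE cscalerAr.
- by rewrite bscaleDr !(linearD (tevl X _)) et ew mulrDr.
Qed.

(** The [j]-th entry functional, extended to [X], sends the section to the sum of the
    [eps(C_ji) b_i], which is [b j] by the counit axiom. *)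
Lemma vanishing_b j : vanishing_ideal lin_section (b j).
Proof.
exists (mklin (bentry_linear j)).
rewrite [LHS]tens_entry_sum.
have := congr1 (fun t => tunit X (tmap (ag_unit G) idfun t)) (hb j).
have -> : tunit X (tmap (ag_unit G) idfun (gs_act X (b j))) = b j.
  exact: (gs_actP X).2.
rewrite (linear_sum (tmap _ _)) (linear_sum (tunit _)) => ->.
apply: eq_bigr => i _; rewrite tmapE tunitE counit_dual // !mxE //.
Qed.

(** The vanishing ideal is generated by the [b i]: each functional takes the section to a
    combination of them, and each of them is attained by [vanishing_b]. *)
Lemma vanishing_lin_section (T : calg A) (x : ahom X T) :
  (forall c, vanishing_ideal lin_section c -> x c = 0) <-> (forall i, x (b i) = 0).
Proof.
split=> [h i|h c [phi <-]]; first exact/h/vanishing_b.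
have -> : lin_section = \sum_i (b i) *: ((1 : X) ⊗ gen_row eD i : bchange X V).
  apply: eq_bigr => i _; rewrite [RHS]bscaleE mulr1 //.
rewrite linear_sum (linear_sum x) big1 // => i _.
by rewrite (linearZZ phi) [x _](ahomM x) h mul0r.
Qed.

End LinearSection.

(** * The Reynolds operator and the fixed locus *)

Section FixedPoints.
Variables (A : comPzRingType) (G : agroup A).
Variable r : {linear reg_gmod G -> triv_gmod G A^o}.
Hypothesis r_eq : equivariant r.
Hypothesis r_str : forall a : A, r (ahom_str G a) = a.

Definition reynolds (M : lmodType A) (mu : {linear M -> tens G M}) : {linear M -> M} :=
  tevr M (r : {linear G -> A^o}) \o mu.

(** By coassociativity the left side is [(id ⊗ r) Delta] applied to the [G]-factor of [mu m], and
    invariance of [r] replaces it by [1 ⊗ r]. *)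
Lemma reynolds_fixed (M : lmodType A) (mu : {linear M -> tens G M}) m : is_coaction mu ->
  tmap idfun (reynolds mu) (mu m) = (1 : G) ⊗ reynolds mu m.
Proof.
case=> mu_assoc _.
have e1 t : tmap (@idfun G) (reynolds mu) t =
    tmap idfun (tevr M (r : {linear G -> A^o})) (tmap idfun mu t).
  elim/tens_ind: t => [|h k|t u et eu]; first by rewrite !linear0.
  - by rewrite !tmapE.
  - by rewrite !linearD et eu.
rewrite e1 -mu_assoc -[reynolds mu m]/(tevr M (r : {linear G -> A^o}) (mu m)).
elim/tens_ind: (mu m) => [|h k|t u et eu]; first by rewrite !linear0 tpure0r.
- rewrite tmapE tevrE.
  have -> : (1 : G) ⊗ (ret r h *: k) = tens_ret r (ag_mul G h) ⊗ k.
    by rewrite tens_ret_mul // -tpureZ.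
  elim/tens_ind: (ag_mul G h : tens G G) => [|a b|v w ev ew].
  + by rewrite tpure0l !linear0 tpure0l.
  + by rewrite tassocE tmapE tevrE tens_retE tpureZ.
  + by rewrite tpureDl !linearD ev ew tpureDl.
- by rewrite !linearD et eu tpureDr.
Qed.

(** A fixed point satisfies [(id ⊗ x) mu = 1 ⊗ x], and applying [r] gives [x rho = x]. Conversely,
    if [x = x rho], then [(id ⊗ x) mu = (id ⊗ x rho) mu = 1 ⊗ x rho], by [reynolds_fixed]. *)
Lemma fixed_pt_reynolds (X : gscheme G) (T : calg A) (x : ahom X T) :
  fixed_pt x <-> forall m, x (m - reynolds (gs_act X) m) = 0.
Proof.
split=> [fx m|h R g t m].
  (* The universal test: the product of [G] and [Spec T] with its two projections. *)
  have e := fx (tens_alg G T) (tens_inl G T) (tens_inr G T) m.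
  have e1 u : apair (tens_inl G T) (ahom_comp (tens_inr G T) x) u = tmap (@idfun G) x u.
    elim/tens_ind: u => [|a b|u v eu ev]; first by rewrite !linear0.
    - by rewrite apairE tmapE; apply: tens_inlr.
    - by rewrite !linearD eu ev.
  have {e} : tmap (@idfun G) x (gs_act X m) = (1 : G) ⊗ x m by rewrite -e1; apply: e.
  move=> /(congr1 (tevr T (r : {linear G -> A^o}))).
  have -> u : tevr T (r : {linear G -> A^o}) (tmap (@idfun G) x u) =
      x (tevr X (r : {linear G -> A^o}) u).
    elim/tens_ind: u => [|a b|u v eu ev]; first by rewrite !linear0.
    - by rewrite tmapE !tevrE linearZ.
    - by rewrite !linearD eu ev.
  rewrite tevrE -[r 1]/(ret r 1) -(rmorph1 (scal G)) ret_scal // scale1r => e.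
  by rewrite linearB; apply/eqP; rewrite subr_eq0; apply/eqP/esym/e.
have e1 u : apair g (ahom_comp t x) u = apair g t (tmap (@idfun G) x u).
  elim/tens_ind: u => [|a b|u v eu ev]; first by rewrite !linear0.
  - by rewrite tmapE !apairE.
  - by rewrite !linearD eu ev.
have xr k : x k = x (reynolds (gs_act X) k).
  by apply/eqP; rewrite -subr_eq0 -linearB h.
have e2 u : tmap (@idfun G) x u =
  tmap (@idfun G) x (tmap (@idfun G) (reynolds (gs_act X)) u).
  elim/tens_ind: u => [|a b|u v eu ev]; first by rewrite !linear0.
  - by rewrite !tmapE /= -xr.
  - by rewrite !linearD eu ev.
apply: (etrans (e1 (gs_act X m))); rewrite e2 reynolds_fixed; last exact: gs_actP.
by rewrite tmapE apairE /= -xr (ahom1 g) mul1r.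
Qed.

End FixedPoints.

(** * Localization *)

Section Localization.
Variables (A : comPzRingType) (f : A).

Section Module.
Variable M : lmodType A.

Lemma scalerXX i j (m : M) : f ^+ i *: (f ^+ j *: m) = f ^+ (i + j) *: m.
Proof. by rewrite scalerA -exprD. Qed.

(** The pair [(m, k)] stands for the fraction [m / f^k]; the extra power [j] allows for [f]-torsion
    and makes the relation transitive. *)
Definition loc_eqv (x y : M * nat) : bool :=
  `[< exists j, f ^+ (j + y.2) *: x.1 = f ^+ (j + x.2) *: y.1 >].

Fact loc_eqv_refl : reflexive loc_eqv.
Proof. by move=> x; apply/asboolP; exists 0. Qed.

Fact loc_eqv_sym : symmetric loc_eqv.
Proof. by move=> x y; apply/asboolP/asboolP => -[j e]; exists j. Qed.

Fact loc_eqv_trans : transitive loc_eqv.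
Proof.
move=> y x z /asboolP[i ei] /asboolP[j ej]; apply/asboolP; exists (i + y.2 + j)%N.
transitivity (f ^+ (j + z.2) *: (f ^+ (i + y.2) *: x.1)).
  by rewrite scalerXX; congr (f ^+ _ *: _); lia.
rewrite ei scalerXX addnC -scalerXX ej scalerXX; congr (f ^+ _ *: _); lia.
Qed.

Definition loc_rel : equiv_rel (M * nat) :=
  EquivRel loc_eqv loc_eqv_refl loc_eqv_sym loc_eqv_trans.

Definition mloc : Type := {eq_quot loc_rel}%qT.
HB.instance Definition _ := Choice.on mloc.

Definition lfrac (m : M) (k : nat) : mloc := (\pi_({eq_quot loc_rel}%qT) (m, k))%qT.

Lemma lfracP m k m' k' : lfrac m k = lfrac m' k' <->
  exists j, f ^+ (j + k') *: m = f ^+ (j + k) *: m'.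
Proof.
split=> [e|h]; last by apply/(eqmodP loc_rel)/asboolP.
have /asboolP := introT (eqmodP loc_rel (m, k) (m', k')) e; exact.
Qed.

Lemma lfracZ m k j : lfrac m k = lfrac (f ^+ j *: m) (j + k).
Proof. by apply/lfracP; exists 0; rewrite add0n scalerA -exprD addnC. Qed.

Lemma lfrac_surj (t : mloc) : exists m k, t = lfrac m k.
Proof.
case e: (repr (t : {eq_quot loc_rel}%qT)) => [m k]; exists m, k.
by rewrite /lfrac -e; apply: esym (reprK _).
Qed.

Lemma lfrac_surj2 (t u : mloc) : exists m m' k, t = lfrac m k /\ u = lfrac m' k.
Proof.
have [m [k ->]] := lfrac_surj t; have [m' [k' ->]] := lfrac_surj u.
exists (f ^+ k' *: m), (f ^+ k *: m'), (k + k')%N.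
by split; [rewrite addnC|]; apply: lfracZ.
Qed.

Definition loc_num (t : mloc) : M := sval (cid (lfrac_surj t)).
Definition loc_den (t : mloc) : nat := sval (cid (svalP (cid (lfrac_surj t)))).

Lemma loc_numK t : t = lfrac (loc_num t) (loc_den t).
Proof. exact: svalP (cid (svalP (cid (lfrac_surj t)))). Qed.

Definition loc_add (t u : mloc) : mloc :=
  lfrac (f ^+ loc_den u *: loc_num t + f ^+ loc_den t *: loc_num u) (loc_den t +
    loc_den u).

Definition loc_scale (a : A) (t : mloc) : mloc := lfrac (a *: loc_num t) (loc_den t).

(** Operations on fractions are defined through chosen representatives; this and the next lemma
    allow arbitrary ones, over a common denominator for sums. *)
Lemma loc_scaleE a m k : loc_scale a (lfrac m k) = lfrac (a *: m) k.
Proof.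
have /lfracP[j e] := loc_numK (lfrac m k); apply/lfracP; exists j.
by rewrite !scalerA !(mulrC _ a) -!scalerA e.
Qed.

Lemma loc_addE m m' k : loc_add (lfrac m k) (lfrac m' k) = lfrac (m + m') k.
Proof.
have /lfracP[i ei] := loc_numK (lfrac m k).
have /lfracP[j ej] := loc_numK (lfrac m' k).
set t := lfrac m k in ei *; set u := lfrac m' k in ej *.
apply/lfracP; exists (i + j + k)%N; rewrite !scalerDr !scalerXX; congr (_ + _).
- transitivity (f ^+ (j + k + loc_den u) *: (f ^+ (i + k) *: loc_num t)).
    by rewrite scalerXX; congr (f ^+ _ *: _); lia.
  by rewrite -ei scalerXX; congr (f ^+ _ *: _); lia.
- transitivity (f ^+ (i + k + loc_den t) *: (f ^+ (j + k) *: loc_num u)).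
    by rewrite scalerXX; congr (f ^+ _ *: _); lia.
  by rewrite -ej scalerXX; congr (f ^+ _ *: _); lia.
Qed.

Fact loc_addA : associative loc_add.
Proof.
move=> t u v; have [m [m' [k [-> ->]]]] := lfrac_surj2 t u.
have [n [l ->]] := lfrac_surj v.
rewrite (lfracZ m k l) (lfracZ m' k l) (lfracZ n l k) [(k + l)%N]addnC.
by rewrite !loc_addE addrA.
Qed.

Fact loc_addC : commutative loc_add.
Proof.
move=> t u; have [m [m' [k [-> ->]]]] := lfrac_surj2 t u.
by rewrite !loc_addE addrC.
Qed.

Definition loc_zero := lfrac 0 0.

Lemma lfrac0 k : lfrac 0 k = loc_zero.
Proof. by apply/lfracP; exists 0; rewrite !scaler0. Qed.

Fact loc_add0 : left_id loc_zero loc_add.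
Proof.
by move=> t; have [m [k ->]] := lfrac_surj t; rewrite -(lfrac0 k) loc_addE add0r.
Qed.

Fact loc_addN : left_inverse loc_zero (loc_scale (- 1)) loc_add.
Proof.
move=> t; have [m [k ->]] := lfrac_surj t.
by rewrite loc_scaleE loc_addE scaleN1r addNr lfrac0.
Qed.

HB.instance Definition _ := GRing.isZmodule.Build mloc loc_addA loc_addC loc_add0
  loc_addN.

Lemma lfracD m m' k : lfrac m k + lfrac m' k = lfrac (m + m') k.
Proof. exact: loc_addE. Qed.

Fact loc_scaleA a b t : loc_scale a (loc_scale b t) = loc_scale (a * b) t.
Proof. by have [m [k ->]] := lfrac_surj t; rewrite !loc_scaleE scalerA. Qed.

Fact loc_scale1 : left_id 1 loc_scale.
Proof. by move=> t; have [m [k ->]] := lfrac_surj t; rewrite loc_scaleE scale1r. Qed.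

Fact loc_scaleDr : right_distributive loc_scale +%R.
Proof.
move=> a t u; have [m [m' [k [-> ->]]]] := lfrac_surj2 t u.
by rewrite lfracD !loc_scaleE scalerDr lfracD.
Qed.

Fact loc_scaleDl t : {morph loc_scale^~ t : a b / a + b}.
Proof.
move=> a b; have [m [k ->]] := lfrac_surj t.
by rewrite !loc_scaleE lfracD scalerDl.
Qed.

HB.instance Definition _ :=
  GRing.Zmodule_isLmodule.Build A mloc loc_scaleA loc_scale1 loc_scaleDr loc_scaleDl.

Lemma scaler_frac a m k : a *: lfrac m k = lfrac (a *: m) k.
Proof. exact: loc_scaleE. Qed.

Lemma lfrac_eq0 m k : lfrac m k = 0 <-> exists j, f ^+ j *: m = 0.
Proof.
split=> [/lfracP[j e]|[j e]].
  by exists j; rewrite -[j]addn0 e scaler0.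
by apply/lfracP; exists j; rewrite scaler0 addn0.
Qed.

End Module.

Local Notation L := (mloc A^o).

Definition loc_mul (x y : L) : L :=
  lfrac ((loc_num x : A) * loc_num y : A^o) (loc_den x + loc_den y).

Lemma loc_mulE (a b : A) k l : loc_mul (lfrac (a : A^o) k) (lfrac (b : A^o) l) =
  lfrac (a * b : A^o) (k + l).
Proof.
have /lfracP[i ei] := loc_numK (lfrac (a : A^o) k).
have /lfracP[j ej] := loc_numK (lfrac (b : A^o) l).
set t := lfrac (a : A^o) k in ei *; set u := lfrac (b : A^o) l in ej *.
apply/lfracP; exists (i + j)%N.
have e c d (x y : A) : f ^+ (c + d) * (x * y) = (f ^+ c * x) * (f ^+ d * y).
  by rewrite exprD mulrACA.
have {}ei : f ^+ (i + loc_den t) * a = f ^+ (i + k) * loc_num t by exact: ei.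
have {}ej : f ^+ (j + loc_den u) * b = f ^+ (j + l) * loc_num u by exact: ej.
apply: esym; change (f ^+ (i + j + (loc_den t + loc_den u)) * (a * b) =
  f ^+ (i + j + (k + l)) * ((loc_num t : A) * loc_num u)).
by rewrite addnACA e ei ej -e addnACA.
Qed.

Fact loc_mulA : associative loc_mul.
Proof.
move=> x y z; have [a [k ->]] := lfrac_surj x; have [b [l ->]] := lfrac_surj y.
have [c [m ->]] := lfrac_surj z;
  rewrite (loc_mulE b c) (loc_mulE a b) !loc_mulE addnA; congr lfrac; exact: mulrA.
Qed.

Fact loc_mulC : commutative loc_mul.
Proof.
move=> x y; have [a [k ->]] := lfrac_surj x; have [b [l ->]] := lfrac_surj y.
rewrite !loc_mulE addnC; congr lfrac; exact: mulrC.
Qed.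

Definition loc_one : L := lfrac (1 : A^o) 0.

Fact loc_mul1 : left_id loc_one loc_mul.
Proof. by move=> x; have [a [k ->]] := lfrac_surj x; rewrite loc_mulE; congr lfrac;
  apply: mul1r. Qed.

Fact loc_mulDl : left_distributive loc_mul +%R.
Proof.
move=> x y z; have [a [b [k [-> ->]]]] := lfrac_surj2 x y.
have [c [m ->]] := lfrac_surj z.
by rewrite lfracD !loc_mulE lfracD; congr lfrac; apply: mulrDl.
Qed.

Fact loc_scaleAl (a : A) x y : loc_mul (a *: x) y = a *: loc_mul x y.
Proof.
have [b [k ->]] := lfrac_surj x; have [c [m ->]] := lfrac_surj y.
rewrite scaler_frac !loc_mulE scaler_frac; congr lfrac; exact: esym (mulrA a b c).
Qed.

Definition loc_alg : calg A := CAlg loc_mulA loc_mulC loc_mul1 loc_mulDl loc_scaleAl.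

Lemma loc_algP : is_localization (ahom_str loc_alg : A -> loc_alg) f.
Proof.
have strE (a : A) : ahom_str loc_alg a = lfrac (a : A^o) 0.
  suff e : a *: loc_one = lfrac (a : A^o) 0 by exact: e.
  rewrite /loc_one scaler_frac; congr lfrac; exact: mulr1.
have lfrac_f a k : lfrac (f ^+ k * a : A^o) k = lfrac (a : A^o) 0.
  by rewrite [RHS](lfracZ (a : A^o) 0 k) addn0.
split.
- exists (lfrac (1 : A^o) 1); rewrite strE [LHS]loc_mulE mulr1.
  by rewrite -[RHS](lfrac_f 1 1) expr1 mulr1.
- move=> y; have [a [k ->]] := lfrac_surj y; exists k, a.
  have -> : ahom_str loc_alg f ^+ k = ahom_str loc_alg (f ^+ k).
    exact: esym (rmorphXn (amorph (ahom_str loc_alg)) k f).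
  by rewrite !strE [LHS]loc_mulE lfrac_f.
- by move=> x; rewrite strE => /lfrac_eq0[k e]; exists k.
Qed.

End Localization.

(** * Base change to a localization *)

Lemma bscaleZ (A : comPzRingType) (R : calg A) (M : lmodType A) (a : A) (x : R) (t :
  bchange R M) :
  bscale (a *: x) t = a *: (bscale x t : tens R M).
Proof.
elim/bchange_ind: t => [|y m|t u et eu].
- by rewrite !bscale0r [RHS](scaler0 (tens R M)).
- by rewrite !bscaleE cscalerAl tpureZl.
- by rewrite !bscaleDr et eu [RHS](@scalerDr A (tens R M)).
Qed.

Lemma bscale_scal (A : comPzRingType) (R : calg A) (M : lmodType A) (a : A) (t :
  bchange R M) :
  bscale (a *: (1 : R)) t = a *: (t : tens R M).
Proof. by rewrite bscaleZ bscale1. Qed.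

Section LocalizedModule.
Variables (A : comPzRingType) (L : calg A) (f : A).
Hypothesis hL : is_localization (ahom_str L : A -> L) f.

Lemma loc_denominator (y : L) : exists k (a : A), f ^+ k *: y = a *: (1 : L).
Proof.
case: hL => _ /(_ y)[k [a e]] _; exists k, a; rewrite -[RHS]e.
by rewrite -[RHS]/(amorph (ahom_str L) f ^+ k * y) -rmorphXn [RHS]scalE.
Qed.

Lemma loc_torsion (a : A) : a *: (1 : L) = 0 -> exists k, f ^+ k * a = 0.
Proof. by case: hL => _ _; apply. Qed.

Section Kernel.
Variable M : lmodType A.

(** The algebra [L] is known only through [is_localization], so [l] is handled through its
    expressions [a / f^k]; the value is [a m / f^k], independent of the expression because elements
    of [A] that vanish in [L] are [f]-torsion. *)
Fact loc_pair_ex (l : L) (m : M) : exists t : mloc f M,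
  forall k (a : A), f ^+ k *: l = a *: (1 : L) -> t = lfrac f (a *: m) k.
Proof.
have [k' [a' e']] := loc_denominator l; exists (lfrac f (a' *: m) k') => k a e.
apply/lfracP; have [j ej] : exists j, f ^+ j * (f ^+ k * a' - f ^+ k' * a) = 0.
  apply: loc_torsion; rewrite scalerBl -!scalerA -e -e' !scalerA.
  by rewrite [f ^+ k * _]mulrC subrr.
exists j; rewrite !scalerA; congr (_ *: _); apply/eqP; rewrite -subr_eq0.
by rewrite !exprD -!mulrA -mulrBr ej.
Qed.

Definition loc_pair (l : L) (m : M) : mloc f M := sval (cid (loc_pair_ex l m)).

Lemma loc_pairE l m k (a : A) : f ^+ k *: l = a *: (1 : L) ->
  loc_pair l m = lfrac f (a *: m) k.
Proof. exact: (svalP (cid (loc_pair_ex l m))). Qed.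

Fact loc_pair_bilin : bilin loc_pair.
Proof.
split=> [m c l l'|l c m m'].
  have [k [a e]] := loc_denominator l; have [k' [a' e']] := loc_denominator l'.
  rewrite (loc_pairE m e) (loc_pairE m e').
  rewrite (@loc_pairE _ m (k' + k)%N (c * (f ^+ k' * a) + f ^+ k * a')); last first.
    rewrite scalerDr scalerDl; congr (_ + _).
    - by rewrite mulrA -[RHS]scalerA -e !scalerA exprD; congr (_ *: _);
      rewrite mulrC mulrA.
    - by rewrite addnC exprD -!scalerA -e'.
  rewrite scaler_frac (lfracZ f _ k k') (lfracZ f _ k' k) [(k + k')%N]addnC lfracD.
  by congr lfrac; rewrite scalerDl !scalerA mulrCA mulrA.
have [k [a e]] := loc_denominator l; rewrite !(loc_pairE _ e) scaler_frac lfracD.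
by rewrite scalerDr !scalerA mulrC.
Qed.

(** The bilinear map [loc_pair] sends [1 ⊗ m] to the fraction [m / 1] of [mloc f M], where vanishing
    means [f]-torsion. *)
Lemma tpure1_eq0 (m : M) : (1 : L) ⊗ m = 0 -> exists k, f ^+ k *: m = 0.
Proof.
move=> /(congr1 (tlift loc_pair_bilin)); rewrite tliftE linear0.
rewrite (@loc_pairE 1 m 0 1) ?expr0 // scale1r => /lfrac_eq0[j e].
by exists j.
Qed.

Lemma tpure1_eq (m m' : M) : (1 : L) ⊗ m = (1 : L) ⊗ m' ->
  exists k, f ^+ k *: m = f ^+ k *: m'.
Proof.
move=> e; have [k ek] : exists k, f ^+ k *: (m - m') = 0.
  by apply: tpure1_eq0; rewrite tpureBr e subrr.
by exists k; apply/eqP; rewrite -subr_eq0 -scalerBr ek.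
Qed.

Lemma tens_denominator (t : tens L M) : exists k m, f ^+ k *: t = (1 : L) ⊗ m.
Proof.
elim/tens_ind: t => [|l m|t u [k [m e]] [k' [m' e']]].
- by exists 0, 0; rewrite scaler0 tpure0r.
- have [k [a e]] := loc_denominator l; exists k, (a *: m).
  by rewrite -tpureZl e tpureZ.
- exists (k' + k)%N, (f ^+ k' *: m + f ^+ k *: m').
  rewrite scalerDr exprD -scalerA e mulrC -scalerA e'.
  by rewrite -!tpureZl !tpureZ -tpureDr.
Qed.

End Kernel.
End LocalizedModule.

Lemma uniform_exponent (T : eqType) (s : seq T) (P : T -> nat -> Prop) :
  (forall x k j, P x k -> P x (j + k)%N) ->
  (forall x, x \in s -> exists k, P x k) -> exists K, forall x, x \in s -> P x K.
Proof.
move=> Pmono; elim: s => [|x s IH] h; first by exists 0.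
have [k Pk] := h x (mem_head _ _).
have [y ys|K PK] := IH; first by apply: h; rewrite inE ys orbT.
exists (K + k)%N => y; rewrite inE => /predU1P[->|/PK]; first exact: Pmono.
by rewrite addnC; apply: Pmono.
Qed.

Section Noetherian.
Variables (A : comPzRingType) (L : calg A) (f : A).
Hypothesis noethA : noetherian A.
Hypothesis hL : is_localization (ahom_str L : A -> L) f.

Fact torsion0 : (0 : A) *: (1 : L) = 0. Proof. exact: scale0r. Qed.
Fact torsionP (a x y : A) : x *: (1 : L) = 0 -> y *: (1 : L) = 0 ->
  (a * x + y) *: (1 : L) = 0.
Proof. by rewrite scalerDl -scalerA => -> ->; rewrite scaler0 addr0. Qed.

(** The kernel of [A -> L] is finitely generated, so one exponent serves for all its elements. *)
Lemma torsion_bounded : exists K, forall a : A, a *: (1 : L) = 0 -> f ^+ K * a = 0.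
Proof.
pose I : submodule A^o := @Submodule A A^o (fun x => (x : A) *: (1 : L) =
  0) torsion0 torsionP.
have [s [sI Is]] := noetherian_ideal noethA I.
have [x k j e|x xs|K hK] := @uniform_exponent _ s (fun x k => f ^+ k * (x : A) = 0).
- by rewrite exprD -mulrA e mulr0.
- exact/(loc_torsion hL)/sI.
have k0 : f ^+ K * (0 : A) = 0 by exact: mulr0.
have kP (a x y : A) : f ^+ K * x = 0 -> f ^+ K * y = 0 -> f ^+ K * (a * x + y) = 0.
  by move=> ex ey; rewrite mulrDr mulrCA ex ey mulr0 addr0.
pose J : submodule A^o := @Submodule A A^o (fun x => f ^+ K * (x : A) = 0) k0 kP.
by exists K => a /Is/(lspan_sub (N := J)); apply.
Qed.

(* Numerators depend linearly on [e] only up to [f]-torsion, which is killed by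
   a fixed power of [f] since [A] is noetherian. *)
Lemma lift_functional (E : lmodType A) (g : seq E) (y : {linear E -> L}) :
  (forall e, lspan g e) -> exists N (phi : {linear E -> A^o}),
    forall e, (phi e : A) *: (1 : L) = f ^+ N *: y e.
Proof.
move=> gE; have [K hK] := torsion_bounded.
have [x k j [a e]|x _|N hN] := @uniform_exponent _ g (fun x k => exists a :
  A, f ^+ k *: y x = a *: (1 : L)).
- by exists (f ^+ j * a); rewrite exprD -!scalerA e.
- by have [k [a e]] := loc_denominator hL (y x); exists k, a.
have n0 : exists a : A, f ^+ N *: y 0 = a *: (1 : L).
  by exists 0; rewrite linear0 scaler0 scale0r.
have nP (c : A) e e' : (exists a : A, f ^+ N *: y e = a *: (1 : L)) ->
    (exists a : A, f ^+ N *: y e' = a *: (1 : L)) ->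
    exists a : A, f ^+ N *: y (c *: e + e') = a *: (1 : L).
  move=> [a ea] [a' ea']; exists (c * a + a').
  by rewrite linearP scalerDr scalerA mulrC -scalerA ea ea' scalerDl scalerA.
have ex e : exists a : A, f ^+ N *: y e = a *: (1 : L).
  by apply: (lspan_sub (N := Submodule n0 nP) hN (gE e)).
pose num e : A := sval (cid (ex e)).
have numE e : f ^+ N *: y e = num e *: (1 : L) by exact: svalP (cid (ex e)).
have lin : linear (fun e => f ^+ K * num e : A^o).
  move=> c e e'; apply/eqP; rewrite -subr_eq0; apply/eqP.
  have t : (num (c *: e + e') - (c * num e + num e')) *: (1 : L) = 0.
    rewrite scalerBl scalerDl -[(c * _) *: _]scalerA -!numE linearP scalerDr !scalerA.
    by rewrite [c * _]mulrC subrr.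
  by rewrite -[RHS](hK _ t) mulrBr mulrDr mulrCA.
exists (K + N)%N, (mklin lin) => e.
by rewrite exprD -[RHS]scalerA numE scalerA.
Qed.

End Noetherian.

(** * Locally free modules of finite rank have dual systems *)

Section DualScale.
Variables (A : comPzRingType) (M : lmodType A).

Definition dual_scale (c : A) (s : seq ({linear M -> A^o} * M)) :=
  [seq (y.1, c *: y.2) | y <- s].

Lemma dual_sum_scale c s x : dual_sum (dual_scale c s) x = c *: dual_sum s x.
Proof.
rewrite /dual_sum big_map scaler_sumr; apply: eq_bigr => y _ /=.
by rewrite !scalerA mulrC.
Qed.

Lemma dual_sum_cat s t x : dual_sum (s ++ t) x = dual_sum s x + dual_sum t x :> M.
Proof. exact: big_cat. Qed.

Lemma dual_sum_cons y s x : dual_sum (y :: s) x = (y.1 x : A) *: y.2 + dual_sum s x :> M.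
Proof. exact: big_cons. Qed.

Lemma dual_sum_nil x : dual_sum [::] x = 0 :> M.
Proof. exact: big_nil. Qed.

End DualScale.

Section LocalBasis.
Variables (A : comPzRingType) (L : calg A) (f : A).
Hypothesis noethA : noetherian A.
Hypothesis hL : is_localization (ahom_str L : A -> L) f.
Variables (E : lmodType A) (q : nat) (F : {linear 'rV[L]_q -> bchange L E}).
Variable F' : bchange L E -> 'rV[L]_q.
Hypothesis FK : cancel F F'.
Hypothesis F'K : cancel F' F.

Definition local_basis j : bchange L E := F (delta_mx 0 j).

Definition local_coord j (e : E) : L := F' ((1 : L) ⊗ e) 0 j.

Lemma bscaleZr (l : L) (a : A) (t : tens L E) : bscale l (a *: t : tens L E) =
  a *: (bscale l t : tens L E).
Proof. exact: (linearZZ (tmap (cmull l) idfun)). Qed.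

Fact local_coord_linear j : linear (local_coord j).
Proof.
move=> a e e'; rewrite /local_coord.
have -> : F' ((1 : L) ⊗ (a *: e + e')) =
  (a *: (1 : L)) *: F' ((1 : L) ⊗ e) + F' ((1 : L) ⊗ e').
  apply: (can_inj FK); rewrite F'K linearP !F'K.
  rewrite tpureDr -tpureZ tpureZl; congr (_ + _).
  by rewrite -[RHS]/(bscale (a *: (1 : L)) ((1 : L) ⊗ e)) bscale_scal.
by rewrite !mxE cscalerAl mul1r.
Qed.

Lemma local_coordK e : (1 : L) ⊗ e = \sum_j bscale (local_coord j e) (local_basis j).
Proof.
rewrite -[LHS]F'K [F' _]row_sum_delta linear_sum.
by apply: eq_bigr => j _; rewrite linearZ.
Qed.

(** The numerators of the local basis do: expand [1 ⊗ e], clear denominators, and return from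
    [L ⊗ E] to [E] at the cost of another power of [f]. *)
Lemma locally_spanned : exists g : seq E, forall e, exists k, lspan g (f ^+ k *: e).
Proof.
have /choice[m hm] : forall j, exists m, exists N, f ^+ N *: (local_basis j :
  tens L E) = (1 : L) ⊗ m.
  by move=> j; have [N [m e]] := tens_denominator hL (local_basis j); exists m, N.
exists (codom m) => e; pose g := codom m.
have [k [z [gz ez]]] : exists k z, lspan g z /\ f ^+ k *: ((1 : L) ⊗ e) = (1 : L) ⊗ z.
  pose Q (t : bchange L E) := exists k z, lspan g z /\ f ^+ k *: (t : tens L E) =
    (1 : L) ⊗ z.
  suff : Q ((1 : L) ⊗ e) by [].
  rewrite local_coordK; apply: (big_ind Q) => [|t u [k [z [gz ez]]] [k' [z' [gz'
    ez']]]|j _].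
  - by exists 0, 0; split; [apply: sm0|rewrite scaler0 tpure0r].
  - exists (k' + k)%N, (f ^+ k' *: z + f ^+ k *: z'); split.
      by apply: smP => //; apply: smZ.
    rewrite [LHS]scalerDr exprD -scalerA ez mulrC -scalerA ez'.
    by rewrite -!tpureZl !tpureZ -tpureDr.
  - have [N eN] := hm j; have [k [a ea]] := loc_denominator hL (local_coord j e).
    exists (N + k)%N, (a *: m j); split; first by apply/smZ/mem_gen/codom_f.
    rewrite exprD -scalerA -bscaleZ ea -bscaleZr eN bscale_scal.
    by rewrite -tpureZ tpureZl.
have [k' e'] : exists k', f ^+ k' *: (f ^+ k *: e) = f ^+ k' *: z.
  by apply: (tpure1_eq hL); rewrite -tpureZ tpureZl.
by exists (k' + k)%N; rewrite exprD -scalerA e'; apply: smZ.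
Qed.

(** The local basis and its coordinate functionals both descend to [A] after multiplication by
    powers of [f], so a power of [f] times the identity of [E] is given by a finite dual sum. *)
Lemma locally_dual (g : seq E) : (forall e, lspan g e) ->
  exists K s, forall e : E, dual_sum s e = f ^+ K *: e.
Proof.
move=> gE.
have part (r : seq 'I_q) : exists N s, forall e : E, (1 : L) ⊗ dual_sum s e =
    f ^+ N *: (\sum_(j <- r) bscale (local_coord j e) (local_basis j) : tens L E).
  elim: r => [|j r [N [s hs]]].
    by exists 0, [::] => e; rewrite dual_sum_nil big_nil tpure0r scaler0.
  have [N1 [phi hphi]] := lift_functional noethA hL (mklin (local_coord_linear j)) gE.
  have [M [m hm]] := tens_denominator hL (local_basis j).
  (* The functional carries [f^N1] and the vector [m] carries [f^M]; scaling [m] by [f^N] and the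
     tail by [f^(M + N1)] gives all terms the same power of [f]. *)
  exists (N + (M + N1))%N, ((phi, f ^+ N *: m) :: dual_scale (f ^+ (M + N1)) s) => e.
  rewrite dual_sum_cons dual_sum_scale big_cons tpureDr [RHS]scalerDr; congr (_ + _).
  - rewrite -!tpureZ /= hphi -[X in X ⊗ _]mulr1 -bscaleE -hm bscaleZr bscaleZ bscaleZ.
    rewrite !scalerA -!exprD; congr (f ^+ _ *: _); lia.
  - by rewrite -tpureZ tpureZl hs scalerA -exprD addnC.
have [N [s hs]] := part (index_enum 'I_q).
have loc e : exists k, f ^+ k *: dual_sum s e = f ^+ k *: (f ^+ N *: e).
  by apply: (tpure1_eq hL); rewrite hs -local_coordK -tpureZ tpureZl.
have [x k j e|x _|K hK] := @uniform_exponent _ g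
  (fun e k => f ^+ k *: dual_sum s e = f ^+ k *: (f ^+ N *: e)).
- by rewrite exprD -!scalerA e.
- exact: loc.
have k0 : f ^+ K *: dual_sum s 0 = f ^+ K *: (f ^+ N *: 0).
  have -> : dual_sum s 0 = 0 by exact: (linear0 (mklin (dual_sum_linear s))).
  by rewrite !scaler0.
have kP (a : A) x y : f ^+ K *: dual_sum s x = f ^+ K *: (f ^+ N *: x) ->
    f ^+ K *: dual_sum s y = f ^+ K *: (f ^+ N *: y) ->
    f ^+ K *: dual_sum s (a *: x + y) = f ^+ K *: (f ^+ N *: (a *: x + y)).
  move=> ex ey; rewrite dual_sum_linear !scalerDr ey; congr (_ + _).
  transitivity (a *: (f ^+ K *: dual_sum s x)); first by rewrite !scalerA mulrC.
  by rewrite ex !scalerA -mulrA mulrC.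
(* The factor [f ^+ K] removes the torsion ambiguity on the generators and hence, both sides being
   linear, on all of [E]. *)
exists (K + N)%N, (dual_scale (f ^+ K) s) => e.
rewrite dual_sum_scale exprD -scalerA.
exact: (lspan_sub (N := Submodule k0 kP) hK (gE e)).
Qed.

End LocalBasis.

Section LocallyFree.
Variables (A : comPzRingType) (E : lmodType A).
Hypothesis noethA : noetherian A.

(** Two applications of [local_unity]: to the scalars that multiply [e] into the span of [gs], which
    gives finite generation, and to the scalars [a] for which [a] times the identity is a dual
    sum. *)
Lemma locally_free_dualizable : locally_free_of_finite_rank E -> dualizable E.
Proof.
case=> n [f [[c cf] free]].
have /choice[g hg] : forall i, exists g :
  seq E, forall e, exists k, lspan g (f i ^+ k *: e).
  by move=> i; have [L [hL [q [F [F' FK F'K]]]]] := free i;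
    apply: (locally_spanned hL F'K).
pose gs := flatten [seq g i | i <- enum 'I_n].
have gsE e : lspan gs e.
  have j0 : lspan gs ((0 : A) *: e) by rewrite scale0r; apply: sm0.
  have jP (a : A) (x y : A^o) : lspan gs ((x : A) *: e) -> lspan gs ((y : A) *: e) ->
      lspan gs (((a *: x + y : A^o) : A) *: e).
    by rewrite scalerDl -[(a *: x : A^o) : A]/(a * x) -scalerA; apply: smP.
  have := @local_unity A (@Submodule A A^o (fun a => lspan gs ((a :
    A) *: e)) j0 jP) n f c cf.
  rewrite /= scale1r; apply=> i; have [k hk] := hg i e; exists k.
  apply: lspan_subset hk => x xg; apply/flattenP; exists (g i) => //.
  by apply: map_f; rewrite mem_enum.
pose J (a : A) := exists s, forall e : E, dual_sum s e = a *: e.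
have j0 : J 0 by exists [::] => e; rewrite dual_sum_nil scale0r.
have jP (a : A) (x y : A^o) : J x -> J y -> J (a *: x + y : A^o).
  move=> [s hs] [t ht]; exists (dual_scale a s ++ t) => e.
  by rewrite dual_sum_cat dual_sum_scale hs ht scalerDl -scalerA.
have [i|s hs] := @local_unity A (@Submodule A A^o J j0 jP) n f c cf; last first.
  by exists s => e; rewrite hs scale1r.
have [L [hL [q [F [F' FK F'K]]]]] := free i.
have [K [s hs]] := locally_dual noethA hL FK F'K gsE.
by exists K, s.
Qed.

End LocallyFree.

(** * The image of an idempotent matrix is locally free *)

Section ImageLocallyFree.
Variables (A : comPzRingType) (n : nat) (e : 'M[A]_n).
Hypothesis e_idem : e *m e = e.
Local Notation V := (smod (row_image e)).

(* By multilinearity the determinants of these matrices sum to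
   [\det (e + (1 - e)) = 1], and where one of them is invertible the rows of [e]
   indexed by [K] form a basis of the image of [e]. *)
Definition mixed_rows (K : {set 'I_n}) : 'M[A]_n :=
  \matrix_(i, j) if i \in K then e i j else (1%:M - e) i j.

Lemma sum_det_mixed_rows : \sum_(K : {set 'I_n}) \det (mixed_rows K) = 1.
Proof.
rewrite -(det1 A n) -[1%:M](subrKC e) exchange_big /=; apply: eq_bigr => s _.
rewrite -mulr_sumr; congr (_ * _).
transitivity (\prod_i (e i (s i) + (1%:M - e) i (s i))).
  rewrite bigA_distr; apply: eq_bigr => K _; apply: eq_bigr => i _; by rewrite mxE.
by apply: eq_bigr => i _; rewrite [in RHS]mxE.
Qed.

Section OneMinor.
Variables (K : {set 'I_n}) (L : calg A).
Hypothesis hL : is_localization (ahom_str L : A -> L) (\det (mixed_rows K)).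
Local Notation E := (map_mx (scal L) e).
Local Notation N := (map_mx (scal L) (mixed_rows K)).

Lemma mixed_rows_inv : exists N' : 'M[L]_n, N *m N' = 1%:M /\ N' *m N = 1%:M.
Proof.
case: hL => -[u hu] _ _; have hd : \det N * u = 1 by rewrite det_map_mx; exact: hu.
exists (u *: \adj N); split.
- by rewrite -scalemxAr mul_mx_adj scale_scalar_mx mulrC hd.
- by rewrite -scalemxAl mul_adj_mx scale_scalar_mx mulrC hd.
Qed.

Definition select : 'M[L]_(#|K|, n) := \matrix_(j, i) (enum_val j == i)%:R.

Lemma select_mul p (M : 'M[L]_(n, p)) j l : (select *m M) j l = M (enum_val j) l.
Proof.
rewrite mxE (bigD1 (enum_val j)) //= mxE eqxx mul1r big1 ?addr0 // => i ne.
by rewrite mxE eq_sym (negPf ne) mul0r.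
Qed.

Lemma select_trK : select *m select^T = 1%:M.
Proof.
apply/matrixP => i j; rewrite select_mul !mxE eq_sym; congr (nat_of_bool _)%:R.
exact: (inj_eq enum_val_inj).
Qed.

Lemma tr_select_mul p (M : 'M[L]_(n, p)) i l :
  (select^T *m (select *m M)) i l = if i \in K then M i l else 0.
Proof.
rewrite mxE; under eq_bigr do rewrite select_mul 2!mxE.
case: ifPn => iK.
  rewrite (bigD1 (enum_rank_in iK i)) //= enum_rankK_in // eqxx mul1r.
  rewrite big1 ?addr0 // => j ne; case: eqP => [ej|_]; last by rewrite mul0r.
  by case/eqP: ne; apply: enum_val_inj; rewrite enum_rankK_in.
rewrite big1 // => j _; case: eqP => [ej|_]; last by rewrite mul0r.
by rewrite -ej enum_valP in iK.
Qed.

Lemma E_idem : E *m E = E.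
Proof. by rewrite -map_mxM e_idem. Qed.

Lemma select_N : select *m N = select *m E.
Proof. by apply/matrixP => j l; rewrite !select_mul !mxE enum_valP. Qed.

(** The rows of [N] outside [K] are rows of [1 - E], which [E] kills. *)
Lemma N_E : N *m E = select^T *m (select *m E).
Proof.
apply/matrixP => i l; rewrite tr_select_mul.
have -> : (N *m E) i l = (row i N *m E) 0 l by rewrite -row_mul [RHS]mxE.
case: ifPn => iK.
  have -> : row i N = row i E by apply/rowP => j; rewrite !mxE iK.
  by rewrite -row_mul E_idem mxE.
have -> : row i N = row i (1%:M - E).
  apply/rowP => j; rewrite !mxE (negPf iK) rmorphB rmorph_nat //.
by rewrite -row_mul mulmxBl mul1mx E_idem subrr !mxE.
Qed.

Definition coords (t : bchange L V) : 'rV[L]_n := \row_i tevl L (entry e i) t.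

Lemma coords_inj : injective coords.
Proof.
move=> t u /rowP h; apply: (tens_entry_inj e_idem) => j.
by have := h j; rewrite !mxE.
Qed.

Lemma coords_sum (w : 'rV[L]_n) : coords (\sum_i w 0 i ⊗ gen_row e_idem i) = w *m E.
Proof.
apply/rowP => j; rewrite mxE tens_entry_sum mxE; apply: eq_bigr => i _.
by rewrite mxE mulrC scalE.
Qed.

Lemma coords_E t : coords t *m E = coords t.
Proof.
rewrite -coords_sum; congr coords; rewrite [RHS](tens_gen_row e_idem).
by apply: eq_bigr => i _; rewrite mxE.
Qed.

Definition minor_basis (c : 'rV[L]_#|K|) : bchange L V :=
  \sum_i (c *m select) 0 i ⊗ gen_row e_idem i.

Fact minor_basis_linear : linear minor_basis.
Proof.
move=> a c d; change (minor_basis (a *: c + d) =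
  bscale a (minor_basis c) + minor_basis d).
rewrite /minor_basis bscale_sum -big_split; apply: eq_bigr => i _ /=.
by rewrite bscaleE -tpureDl mulmxDl -scalemxAl !mxE.
Qed.

(** In coordinates the map is [c |-> c select E = c select N], which is undone by the inverse of [N]
    followed by the transpose of [select]. The other composite is the identity by [N_E]. *)
Lemma minor_free : free_of_finite_rank (bchange L V).
Proof.
exists #|K|, (mklin minor_basis_linear).
have [N' [NN' N'N]] := mixed_rows_inv.
exists (fun t => coords t *m N' *m select^T) => [c|t].
  by rewrite [coords _]coords_sum -!mulmxA (mulmxA select) -select_N -!mulmxA (mulmxA
    N) NN' mul1mx select_trK mulmx1.
apply: coords_inj; rewrite [LHS]coords_sum.
by rewrite -!mulmxA -N_E (mulmxA N') N'N mul1mx coords_E.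
Qed.

End OneMinor.

Lemma row_image_locally_free : locally_free_of_finite_rank V.
Proof.
exists #|{set 'I_n}|, (fun i => \det (mixed_rows (enum_val i))); split.
  exists (fun=> 1); under eq_bigr do rewrite mul1r.
  by rewrite -sum_det_mixed_rows [RHS](reindex (@enum_val _ {set 'I_n})) //;
    apply: onW_bij; apply: enum_val_bij.
move=> i; exists (loc_alg (\det (mixed_rows (enum_val i)))); split; first exact: loc_algP.
exact: (minor_free (loc_algP _)).
Qed.

End ImageLocallyFree.

(** * The section defining the fixed locus *)

Section CoefficientMatrix.
Variables (A : comPzRingType) (G : agroup A) (E : gmod G) (n : nat).
Variables (phi : 'I_n -> {linear E -> A^o}) (v : 'I_n -> E).
Hypothesis phi_dual : forall x, \sum_j (phi j x : A) *: v j = x.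

Definition coef_matrix : 'M[G]_n := \matrix_(i, j) tevl G (phi j) (gm_coact E (v i)).

Lemma coact_coef_matrix i : gm_coact E (v i) = \sum_j coef_matrix i j ⊗ v j.
Proof.
have h x : dual_sum [seq (phi j, v j) | j <- enum 'I_n] x = x.
  by rewrite /dual_sum big_map big_enum.
rewrite [LHS](tens_dual_r _ h) big_map big_enum; apply: eq_bigr => j _.
by rewrite mxE.
Qed.

(** Coassociativity for [v i], contracted with [phi j] in the last factor. *)
Lemma coef_matrix_comatrix : comatrix coef_matrix.
Proof.
have h j (t : tens G E) : ag_mul G (tevl G (phi j) t) =
    tmap idfun (tevl G (phi j)) (tassoc _ _ _ (tmap (ag_mul G) idfun t)).
  elim/tens_ind: t => [|a x|t u et eu]; first by rewrite !linear0.
  - rewrite tmapE tevlE (linearZZ (ag_mul G)).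
    elim/tens_ind: (ag_mul G a : tens G G) => [|b c|w w' ew ew'].
    + by rewrite tpure0l !linear0.
    + by rewrite tassocE tmapE tevlE -tpureZ tpureZl.
    + by rewrite tpureDl !linearD -ew -ew'.
  - by rewrite !linearD et eu.
apply/matrixP => i j; rewrite mxE [coef_matrix i j]mxE h coact_assoc.
rewrite coact_coef_matrix (linear_sum (tmap idfun (gm_coact E))) (linear_sum (tmap _
  (tevl G _))) [RHS]mxE; apply: eq_bigr => k _.
rewrite !tmapE [X in _ = X * _]mxE [X in _ = _ * X]mxE tens_inlr.
by rewrite [coef_matrix k j]mxE.
Qed.

End CoefficientMatrix.

Section NoetherianFamily.
Variables (B : comPzRingType) (T : eqType) (d : T -> B).

(** The ideal generated by all [d m] has finitely many generators, and each of them is a combination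
    of finitely many [d m]. *)
Lemma noetherian_finite_family : noetherian B ->
  exists l : seq T, forall m, lspan ([seq d x | x <- l] : seq B^o) (d m).
Proof.
move=> nB; pose I : submodule B^o := @gen B B^o (fun x => exists m, x = d m).
have [s [sI Is]] := noetherian_ideal nB I.
suff [l hl] : exists l : seq T, forall x, x \in s ->
  lspan ([seq d y | y <- l] : seq B^o) x.
  by exists l => m; apply: (lspan_sub hl); apply/Is/(@mem_gen B B^o); exists m.
have sub (l l' : seq T) (x : B^o) : {subset l <= l'} ->
    lspan ([seq d y | y <- l] : seq B^o) x -> lspan ([seq d y | y <- l'] : seq B^o) x.
  move=> ll'; apply: lspan_subset => y /mapP[z zl ->]; apply/map_f/ll'/zl.
have f0 : exists l : seq T, lspan ([seq d y | y <- l] : seq B^o) 0.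
  by exists [::]; apply: sm0.
have fP (a : B) (x y : B^o) : (exists l : seq T, lspan ([seq d y | y <- l] :
  seq B^o) x) ->
    (exists l : seq T, lspan ([seq d y | y <- l] : seq B^o) y) ->
    exists l : seq T, lspan ([seq d y | y <- l] : seq B^o) (a *: x + y).
  move=> [l hl] [l' hl']; exists (l ++ l'); apply: smP.
  - by apply: sub hl => z zl; rewrite mem_cat zl.
  - by apply: sub hl' => z zl; rewrite mem_cat zl orbT.
have {sI} : forall x, x \in s -> exists l : seq T, lspan ([seq d y | y <- l] : seq B^o) x.
  move=> x /sI /(_ (Submodule f0 fP)); apply => _ [m ->].
  by exists [:: m]; apply: mem_gen; rewrite inE.
elim: s {Is} => [|x s IH] h; first by exists [::].
have [l hl] := h x (mem_head _ _).
have [y ys|l' hl'] := IH; first by apply: h; rewrite inE ys orbT.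
exists (l ++ l') => y; rewrite inE => /predU1P[->|/hl'].
- by apply: sub hl => z zl; rewrite mem_cat zl.
- by apply: sub => z zl; rewrite mem_cat zl orbT.
Qed.

End NoetherianFamily.

(** * Removing the invariant part of a vector of functions, and the theorem *)

Section Main.
Variables (A : comPzRingType) (G : agroup A) (X : gscheme G).
Variable r : {linear reg_gmod G -> triv_gmod G A^o}.
Hypothesis r_eq : equivariant r.
Hypothesis r_str : forall a : A, r (ahom_str G a) = a.
Local Notation rho := (reynolds r (gs_act X)).

Definition scheme_gmod : gmod G := GMod (gs_actP X).

(** In matrix form [b - rho b = (1 - R) b]. Its coaction is [(C - R C) b = (C - R) b], and this
    equals [(C - R) (1 - R) b] because [(C - R) R = 0]. *)
Lemma nonfixed_vector n (C : 'M[G]_n) (b : 'I_n -> X) : comatrix C ->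
  (forall i, gs_act X (b i) = \sum_j C i j ⊗ b j) ->
  forall i, gs_act X (b i - rho (b i)) = \sum_j nonfixed r C i j ⊗ (b j - rho (b j)).
Proof.
move=> hC hb; pose R := map_mx (ret r) C.
have hrho i : rho (b i) = \sum_j R i j *: b j.
  rewrite -[LHS]/(tevr X (r : {linear G -> A^o}) (gs_act X (b i))) hb.
  rewrite (linear_sum (tevr X _)); apply: eq_bigr => j _.
  by rewrite tevrE mxE.
have RC i k : \sum_j R i j *: C j k = R i k *: (1 : G).
  have /matrixP/(_ i k) := ret_mul_comatrix r_eq r_str hC; rewrite !mxE => e.
  by rewrite -[RHS]e; apply: eq_bigr => j _; rewrite [in RHS]mxE scalE.
have CR i k : \sum_j nonfixed r C i j * scal G (R j k) = 0.
  have : nonfixed r C *m map_mx (scal G) R = 0.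
    by rewrite mulmxBl comatrix_mul_ret // -map_mxM ret_idem // subrr.
  move=> /matrixP/(_ i k); rewrite mxE [RHS]mxE => e; rewrite -[RHS]e.
  by apply: eq_bigr => j _; rewrite [map_mx (scal G) R j k]mxE.
move=> i.
have -> : \sum_j nonfixed r C i j ⊗ (b j - rho (b j)) = \sum_j nonfixed r C i j ⊗ b j.
  under eq_bigr => j _ do rewrite tpureBr.
  rewrite sumrB [X in _ - X](_ : _ = 0) ?subr0 //.
  under eq_bigr => j _ do rewrite hrho tpure_sumr.
  rewrite exchange_big big1 //= => k _.
  under eq_bigr => j _ do rewrite -tpureZ -scalE mulrC.
  by rewrite -tpure_suml CR tpure0l.
rewrite linearB hrho linear_sum.
have -> : \sum_j gs_act X (R i j *: b j) = \sum_k (R i k *: (1 : G)) ⊗ b k.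
  under eq_bigr => j _ do rewrite (linearZZ (gs_act X)) hb scaler_sumr.
  rewrite exchange_big; apply: eq_bigr => k _.
  by rewrite -RC tpure_suml; apply: eq_bigr => j _; rewrite tpureZl.
rewrite hb -sumrB; apply: eq_bigr => j _.
by rewrite -tpureBl !mxE.
Qed.

End Main.

Theorem theorem1 (A : comPzRingType) (G : agroup A) (X : gscheme G)
  (noetherianS : noetherian A)
  (finite_typeG : finite_type G)
  (reductiveG : linearly_reductive G)
  (resolutionG : resolution_property G)
  (projectiveG : locally_projective G)
  (noetherianX : noetherian X) :
  exists V : gmod G,
    [/\ locally_free_of_finite_rank V,
        forall v : V, gm_fixed v -> v = 0%R
      & exists s : bchange X V,
          equivariant_section s /\ is_fixed_locus (vanishing_ideal s)].
Proof.
case: reductiveG => r [r_eq r_str].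
have dG := locally_projective_dualizable projectiveG.
pose rho := reynolds r (gs_act X); pose d (m : X) : X := m - rho m.
(* The ideal of the fixed locus is generated by the [d m] with [m] in the finite list [l]. *)
have [l hl] := @noetherian_finite_family X X d noetherianX.
have [E [p [lfE eq_p pl]]] := @resolution_cover _ _ (scheme_gmod X) noetherianS dG l
  resolutionG.
have [s hs] := locally_free_dualizable noetherianS lfE.
pose phi j := (tnth (in_tuple s) j).1; pose v j := (tnth (in_tuple s) j).2.
have phi_dual x : \sum_j (phi j x : A) *: v j = x.
  by rewrite -[RHS]hs /dual_sum [RHS]big_tnth.
pose C := coef_matrix phi v; pose b j : X := p (v j).
have hC : comatrix C := coef_matrix_comatrix phi_dual.
have hb i : gs_act X (b i) = \sum_j C i j ⊗ b j.
  transitivity (tmap idfun p (gm_coact E (v i))); first exact: eq_p.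
  rewrite (coact_coef_matrix phi_dual) (linear_sum (tmap _ _)).
  by apply: eq_bigr => j _; rewrite tmapE.
have hC' := comatrix_nonfixed r_eq r_str hC.
have hb' := nonfixed_vector r_eq r_str hC hb.
exists (cmod (comatrix_dual hC')); split.
- exact: (row_image_locally_free (counit_idem (comatrix_dual hC'))).
(* A fixed vector satisfies [w = w D]; applying [r] entrywise gives [w = w r(D) = 0]. *)
- move=> w /cmod_fixed /(congr1 (map_mx (ret r))).
  rewrite map_ret_mull // map_ret_scal // (ret_dual r_eq r_str) ?ret_nonfixed // mulmx0.
  by move=> w0; apply: (@smincl_inj _ _ (row_image _)); rewrite -w0 linear0.
exists (lin_section (fun i => d (b i)) hC'); split;
  first exact: lin_section_equivariant hb'.
move=> T x; rewrite (vanishing_lin_section hC' hb') (fixed_pt_reynolds r_eq r_str).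
split=> [h m|h i]; last exact: h.
have j0 : x (0 : X) = 0 by exact: linear0.
have jP (a y z : X) : x y = 0 -> x z = 0 -> x (a * y + z) = 0.
  by move=> ey ez; rewrite linearD (ahomM x) ey ez mulr0 addr0.
pose J : submodule (X : comPzRingType)^o :=
  @Submodule X (X : comPzRingType)^o (fun y => x y = 0) j0 jP.
(* Each generator is [d (p e)] for some [e] in [E]; as [d] and [p] are linear over [A], it is an
   [A]-combination of the [d (b j)], which [x] kills. *)
apply: (lspan_sub (N := J) _ (hl m)) => _ /mapP[y /pl[e <-] ->].
rewrite -(phi_dual e) /=.
have -> : d (p (\sum_j (phi j e : A) *: v j)) = \sum_j (phi j e : A) *: d (b j).
  rewrite /d (linear_sum p) (linear_sum rho) -sumrB; apply: eq_bigr => j _.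
  by rewrite (linearZZ p) (linearZZ rho) -scalerBr.
rewrite linear_sum big1 // => j _; apply: (etrans (linearZZ (ahom_lin x) _ _)).
by rewrite [ahom_lin x _]h; apply: scaler0.
Qed.
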